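(* Let $M$ be a smooth manifold modelled on a Banach space $\mathbb{E}$ with atlas $\{(U_\alpha,\psi_\alpha)\}_{\alpha\in I}$, let $k\ge1$, let $\nabla$ be a linear connection on $M$ with local components $\{\Gamma_\alpha\}_{\alpha\in I}$, and let $\stackrel{1}{M}_\alpha,\dots,\stackrel{k}{M}_\alpha$ be the local components of the induced connection map on $T^kM$ (defined recursively from $\Gamma_\alpha$ in the context). For $\alpha\in I$ define $$\Phi_\alpha^k:\pi_k^{-1}(U_\alpha)\to\psi_\alpha(U_\alpha)\times\mathbb{E}^k,\qquad [\gamma,x]_k\mapsto\big(\gamma_\alpha(0),\gamma_\alpha'(0),z_\alpha^2([\gamma,x]_k),\dots,z_\alpha^k([\gamma,x]_k)\big),$$ where $\gamma_\alpha=\psi_\alpha\circ\gamma$ and, for $2\le i\le k$, $$z_\alpha^i([\gamma,x]_k)=\frac1i\Big\{\frac{1}{(i-1)!}\gamma_\alpha^{(i)}(0)+\sum_{j=1}^{i-1}\frac{1}{(i-j-1)!}\stackrel{j}{M}_\alpha\Big[\gamma_\alpha(0),\gamma_\alpha'(0),\dots,\tfrac{1}{j!}\gamma_\alpha^{(j)}(0)\Big]\gamma_\alpha^{(i-j)}(0)\Big\}.$$ Then the trivializations $\{(\pi_k^{-1}(U_\alpha),\Phi_\alpha^k)\}_{\alpha\in I}$ define a vector bundle structure on $\pi_k:T^kM\to M$ with structure group $GL(\mathbb{E}^k)$. Moreover, whenever $U_{\alpha\beta}=U_\alpha\cap U_\beta\neq\emptyset$, for any $(x,\xi_1,\dots,\xi_k)\in\psi_\alpha(U_{\alpha\beta})\times\mathbb{E}^k$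 we have $$\Phi_\beta^k\circ(\Phi_\alpha^k)^{-1}(x,\xi_1,\xi_2,\dots,\xi_k)=\big(\psi_{\beta\alpha}(x),d\psi_{\beta\alpha}(x)\xi_1,\dots,d\psi_{\beta\alpha}(x)\xi_k\big),\qquad \psi_{\beta\alpha}=\psi_\beta\circ\psi_\alpha^{-1}.$$
   Context: For $x_0\in M$ let $C_{x_0}$ be the set of smooth curves $\gamma:(-\epsilon,\epsilon)\to M$ with $\gamma(0)=x_0$; $\gamma_1\approx^k_{x_0}\gamma_2$ iff $\gamma_1^{(j)}(0)=\gamma_2^{(j)}(0)$ for $1\le j\le k$ (in a chart). $T^kM=\bigcup_{x\in M}C_x/\approx^k_x$, the class of $\gamma$ is $[\gamma,x]_k$, and $\pi_k:T^kM\to M$, $[\gamma,x]_k\mapsto x$. $T^kM$ carries the smooth manifold structure (modelled on $\mathbb{E}^{k+1}$) with charts $\Psi_\alpha^k:\pi_k^{-1}(U_\alpha)\to\psi_\alpha(U_\alpha)\times\mathbb{E}^k$, $[\gamma,x]_k\mapsto\big((\psi_\alpha\circ\gamma)(0),(\psi_\alpha\circ\gamma)'(0),\dots,\frac1{k!}(\psi_\alpha\circ\gamma)^{(k)}(0)\big)$. A linear connection $\nabla$ on $M$ is given by local components $\Gamma_\alpha$, $\alpha\in I$: smooth maps $\psi_\alpha(U_\alpha)\to L^2(\mathbb{E},\mathbb{E};\mathbb{E})$ into the continuous bilinear maps, written $(x;\xi,y)\mapsto\Gamma_\alpha(x,\xi)y$, such that on overlaps $d\psi_{\beta\alpha}(x)[\Gamma_\alpha(x,\xi)y]=d^2\psi_{\beta\alpha}(x)(\xi,y)+\Gamma_\beta\big(\psi_{\beta\alpha}(x),d\psi_{\beta\alpha}(x)\xi\big)\,d\psi_{\beta\alpha}(x)y$.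 The local components of the induced connection map are defined by $\stackrel{1}{M}_\alpha(x,\xi_1)y=\Gamma_\alpha(x,\xi_1)y$ and, for $2\le i\le k$, $$\stackrel{i}{M}_\alpha(x,\xi_1,\dots,\xi_i)y=\frac1i\Big(\sum_{l=1}^{i}\partial_l\stackrel{i-1}{M}_\alpha(x,\xi_1,\dots,\xi_{i-1})(y,l\xi_l)+\stackrel{1}{M}_\alpha(x,\xi_1)\big[\stackrel{i-1}{M}_\alpha(x,\xi_1,\dots,\xi_{i-1})y\big]\Big),$$ where $\partial_l$ is the partial derivative with respect to the $l$-th of the variables $(x,\xi_1,\dots,\xi_{i-1})$ (so $x$ is the first variable, $\xi_1$ the second, etc.), and $\partial_l\stackrel{i-1}{M}_\alpha(\cdot)(y,v)$ is the derivative in direction $v$ in the $l$-th variable of the map $(x,\xi_1,\dots,\xi_{i-1})\mapsto\stackrel{i-1}{M}_\alpha(x,\xi_1,\dots,\xi_{i-1})y$ with $y$ fixed. *)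

(* Defs.v *)
From HB Require Import structures.
From mathcomp Require Import all_boot all_order all_algebra.
From mathcomp Require Import all_classical all_reals all_analysis.

Set Implicit Arguments.
Unset Strict Implicit.
Unset Printing Implicit Defensive.
Import Order.TTheory GRing.Theory Num.Theory.
Import numFieldNormedType.Exports.
Local Open Scope classical_set_scope.
Local Open Scope ring_scope.

Section ContinuousLinearMaps.
Context {R : realType} (E F : normedModType R).

Definition clin_pred : {pred E -> F} :=
  [pred f | `[< linear f /\ continuous f >]].

(* L(E, F); continuous bilinear maps L^2(E, E; E) are represented by
   L(E, L(E, E)). *)
Record clin := CLin { clin_fun :> E -> F; clin_funP : clin_fun \in clin_pred }.

HB.instance Definition _ := [isSub for clin_fun].
HB.instance Definition _ := [Choice of clin by <:].

Lemma clin_submod_closed : submod_closed clin_pred.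
Proof.
split=> [|a f g]; first apply/asboolP; first split.
- by move=> b x y; rewrite scaler0 addr0.
- by move=> x; exact: cst_continuous.
move=> /asboolP[lf cf] /asboolP[lg cg]; apply/asboolP; split=> [b x y|x].
  rewrite /= !fctE lf lg !scalerDr !scalerA (mulrC a b) -!addrA; congr (_ + _).
  by rewrite addrCA.
by apply: continuousD; [apply: continuousZ; [exact: cst_continuous|exact: cf]|exact: cg].
Qed.

HB.instance Definition _ := GRing.isSubmodClosed.Build R (E -> F) clin_pred
  clin_submod_closed.
HB.instance Definition _ := [SubChoice_isSubLmodule of clin by <:].

Lemma clin_linear (f : clin) : linear f.
Proof. by have /asboolP[] := clin_funP f. Qed.

Lemma clin_continuous (f : clin) : continuous f.
Proof. by have /asboolP[] := clin_funP f. Qed.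

Definition clin_norm (f : clin) : R := sup [set `|f x| | x in [set x | `|x| <= 1]].

Let pack_linear (f : clin) : {linear E -> F} :=
  HB.pack (f : E -> F) (GRing.isLinear.Build R E F _ (f : E -> F) (@clin_linear f)).

Lemma clinZ (f : clin) a x : f (a *: x) = a *: f x.
Proof. exact: (linearZ_LR (pack_linear f)). Qed.

Lemma clin0 (f : clin) : f 0 = 0.
Proof. exact: (linear0 (pack_linear f)). Qed.

Lemma clin_bounded (f : clin) : exists r, forall x, `|f x| <= r * `|x|.
Proof.
have : bounded_near (pack_linear f) (nbhs (0 : E)).
  by apply: continuous_linear_bounded; exact: (@clin_continuous f 0).
by move=> /linear_boundedP /pinfty_ex_gt0 [r _ fr]; exists r.
Qed.

Lemma clin_has_sup (f : clin) :
  has_sup [set `|f x| | x in [set x | `|x| <= 1]].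
Proof.
have [r fr] := clin_bounded f; split.
  by exists `|f 0|, 0 => //=; rewrite normr0.
exists `|r| => _ [x /= x1 <-]; apply: (le_trans (fr x)).
by rewrite (le_trans (ler_norm _))// normrM normr_id ler_piMr.
Qed.

Lemma clin_norm_ge (f : clin) x : `|x| <= 1 -> `|f x| <= clin_norm f.
Proof.
by move=> x1; apply: ub_le_sup; [exact: (clin_has_sup f).2 | exists x].
Qed.

Lemma clin_norm_le (f : clin) (c : R) :
  (forall x, `|x| <= 1 -> `|f x| <= c) -> clin_norm f <= c.
Proof.
by move=> fc; apply: ge_sup; [exact: (clin_has_sup f).1 | move=> _ [x /fc + <-]].
Qed.

Lemma clin_normD (f g : clin) : clin_norm (f + g) <= clin_norm f + clin_norm g.
Proof.
apply: clin_norm_le => x x1; apply: (le_trans (ler_normD _ _)).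
by apply: lerD; exact: clin_norm_ge.
Qed.

Lemma clin_normZ_le (a : R) (f : clin) :
  clin_norm (a *: f) <= `|a| * clin_norm f.
Proof.
by apply: clin_norm_le => x x1; rewrite [X in `|X|]/(a *: f x) normrZ ler_wpM2l// clin_norm_ge.
Qed.

Lemma clin_normZ (a : R) (f : clin) : clin_norm (a *: f) = `|a| * clin_norm f.
Proof.
apply/le_anti; rewrite clin_normZ_le /=.
have [->|a0] := eqVneq a 0.
  rewrite normr0 mul0r.
  by rewrite (le_trans (normr_ge0 ((0 *: f : clin) 0)))// clin_norm_ge// normr0.
rewrite -ler_pdivlMl ?normr_gt0// -normfV.
by apply: le_trans (clin_normZ_le _ _); rewrite scalerA mulVf// scale1r.
Qed.

Lemma clin_norm0_eq0 (f : clin) : clin_norm f = 0 -> f = 0.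
Proof.
move=> f0; apply/val_inj/funext => x /=.
have [->|x0] := eqVneq x 0; first exact: clin0.
have : `|f (`|x|^-1 *: x)| <= 0.
  rewrite -f0; apply: clin_norm_ge.
  by rewrite normrZ normfV normr_id mulVf// normr_eq0.
rewrite normr_le0 clinZ scaler_eq0 invr_eq0 normr_eq0 (negbTE x0) /=.
by move=> /eqP.
Qed.

HB.instance Definition _ := Lmodule_isNormed.Build R clin
  clin_normD clin_normZ clin_norm0_eq0.

End ContinuousLinearMaps.

Definition epow {R : realType} (E : normedModType R) (n : nat) : Type :=
  {ffun 'I_n -> E}.

Section FinitePowers.
Context {R : realType} (E : normedModType R) (n : nat).

HB.instance Definition _ := GRing.Lmodule.copy (epow E n) {ffun 'I_n -> E}.

Implicit Types v w : epow E n.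

Definition epow_norm (v : epow E n) : R := \big[Num.max/0]_(i < n) `|v i|.

Lemma epow_norm_ge v i : `|v i| <= epow_norm v.
Proof. exact: (le_bigmax_cond 0 (fun i => `|v i|)). Qed.

Lemma epow_normD v w : epow_norm (v + w) <= epow_norm v + epow_norm w.
Proof.
apply/bigmax_leP; split=> [|i _].
  by apply: addr_ge0; apply: bigmax_ge_id.
rewrite ffunE; apply: (le_trans (ler_normD _ _)).
by apply: lerD; exact: epow_norm_ge.
Qed.

Lemma epow_normZ (a : R) v : epow_norm (a *: v) = `|a| * epow_norm v.
Proof.
rewrite /epow_norm; elim/big_ind2: _ => [|x x' y y' -> ->|i _].
- by rewrite mulr0.
- by rewrite maxr_pMr.
- by rewrite ffunE normrZ.
Qed.

Lemma epow_norm0_eq0 v : epow_norm v = 0 -> v = 0.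
Proof.
move=> v0; apply/ffunP => i; rewrite ffunE; apply/eqP.
by rewrite -normr_le0 -v0 epow_norm_ge.
Qed.

HB.instance Definition _ := Lmodule_isNormed.Build R (epow E n)
  epow_normD epow_normZ epow_norm0_eq0.

End FinitePowers.

Section Smoothness.
Context {R : realType} {V : normedModType R}.

(* The differential as an element of L(V, W), meaningful where f is
   differentiable *)
Definition diffL {W : normedModType R} (f : V -> W) (x : V) : clin V W :=
  insubd 0 ('d f x : V -> W).

(* C^n in the Frechet sense on the set A, meant for A open: only the germs of f
   at the points of A matter. *)
Fixpoint Cn (n : nat) (W : normedModType R) (A : set V) (f : V -> W) : Prop :=
  if n is m.+1 then
    (forall x, A x -> differentiable f x) /\ Cn m A (diffL f)
  else forall x, A x -> {for x, continuous f}.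

Definition smooth_on {W : normedModType R} (A : set V) (f : V -> W) : Prop :=
  forall n, Cn n A f.

End Smoothness.

Section Manifolds.
Context {R : realType}.

(* g \o f^-1 on f @` A, for f injective on A (and 0 outside f @` A) *)
Definition comp_inv {X : Type} {E F : normedModType R}
    (A : set X) (f : X -> E) (g : X -> F) (y : E) : F :=
  xget 0 (g @` (A `&` f @^-1` [set y])).

(* g \o f^-1 is smooth on the open set f @` A *)
Definition smooth_transition {X : Type} {E F : normedModType R}
    (A : set X) (f : X -> E) (g : X -> F) : Prop :=
  open (f @` A) /\ smooth_on (f @` A) (comp_inv A f g).

(* Smooth atlas on a set X modelled on E. As usual for Banach manifolds, X
   carries no prior topology: its topology is the one induced by the charts.
   A chart is a total function of which only the restriction to its domain
   matters. *)
Record smooth_atlas {X I : Type} {E : normedModType R}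
    (U : I -> set X) (phi : I -> X -> E) : Prop := {
  atlas_cover : \bigcup_a U a = setT ;
  atlas_inj : forall a, {in U a &, injective (phi a)} ;
  atlas_smooth : forall a b, smooth_transition (U a `&` U b) (phi a) (phi b) }.

(* Since the charts of X are homeomorphisms onto open sets, openness of
   phi a @` (U a `&` f @^-1` V b) for all a and b is continuity of f. *)
Definition smooth_map {X Y I J : Type} {E F : normedModType R}
    (U : I -> set X) (phi : I -> X -> E) (V : J -> set Y) (psi : J -> Y -> F)
    (f : X -> Y) : Prop :=
  forall a b, smooth_transition (U a `&` f @^-1` V b) (phi a) (psi b \o f).

Definition GL (F : normedModType R) : set (clin F F) :=
  [set A | exists B : clin F F, cancel A B /\ cancel B A].

(* The trivializations (p @^-1` U a, Phi a), with values in phi a @` U a times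
   F, define a vector bundle with fibre F and structure group GL(F) on the
   smooth map p from the manifold (T, V, chi) to the manifold (X, U, phi). *)
Record vector_bundle {X T I J : Type} {E G F : normedModType R}
    (U : I -> set X) (phi : I -> X -> E) (V : J -> set T) (chi : J -> T -> G)
    (p : T -> X) (Phi : I -> T -> E * F) : Prop := {
  vb_base : smooth_atlas U phi ;
  vb_total : smooth_atlas V chi ;
  vb_proj : smooth_map V chi U phi p ;
  vb_triv_proj : forall a u, U a (p u) -> (Phi a u).1 = phi a (p u) ;
  (* Phi a is a diffeomorphism from p @^-1` U a onto phi a @` U a times F *)
  vb_triv_inj : forall a, {in p @^-1` U a &, injective (Phi a)} ;
  vb_triv_image : forall a,
    Phi a @` (p @^-1` U a) = (phi a @` U a) `*` [set: F] ;
  vb_triv_smooth : forall a j,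
    smooth_transition (p @^-1` U a `&` V j) (Phi a) (chi j) /\
    smooth_transition (p @^-1` U a `&` V j) (chi j) (Phi a) ;
  (* linear structures on the fibres for which every Phi a is fibrewise linear;
     the module laws follow, Phi a being bijective from each fibre to F *)
  vb_fibre : exists (add : T -> T -> T) (scale : R -> T -> T),
    forall a x, U a x ->
      (forall u v, p u = x -> p v = x ->
        p (add u v) = x /\ (Phi a (add u v)).2 = (Phi a u).2 + (Phi a v).2) /\
      (forall c u, p u = x ->
        p (scale c u) = x /\ (Phi a (scale c u)).2 = c *: (Phi a u).2) ;
  vb_cocycle : forall a b, exists g : E -> clin F F,
    let W := U a `&` U b in
    smooth_on (phi a @` W) g /\
    forall x, (phi a @` W) x -> GL (g x) /\
      forall v : F, comp_inv (p @^-1` W) (Phi a) (Phi b) (x, v) =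
        (comp_inv W (phi a) (phi b) x, g x v) }.

End Manifolds.

Section LinearConnections.
Context {R : realType} {E : normedModType R}.

(* Gamma a x xi y stands for Gamma_a(x, xi) y *)
Record linear_connection {M I : Type} (U : I -> set M) (psi : I -> M -> E)
    (Gamma : I -> E -> clin E (clin E E)) : Prop := {
  connection_smooth : forall a, smooth_on (psi a @` U a) (Gamma a) ;
  connection_transition : forall a b x xi y, (psi a @` (U a `&` U b)) x ->
    let h := comp_inv (U a `&` U b) (psi a) (psi b) in
    diffL h x (Gamma a x xi y) =
      diffL (diffL h) x xi y
      + Gamma b (h x) (diffL h x xi) (diffL h x y) }.

(* derivative of f in direction v in the l-th variable, l counted from 0 *)
Definition partial {n} (f : epow E n -> E) (u : epow E n) (l : 'I_n) (v : E) : E :=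
  'D_v (fun w : E => f [ffun j => if j == l then w else u j]) (u l).

(* The local component M^i, as a function of u = (x, xi_1, ..., xi_i) and y;
   the value for i = 0 is not used. The variable with index l is xi_l, x being
   xi_0, so that it is the (l+1)-st variable. *)
Fixpoint connM (Gamma : E -> clin E (clin E E)) (i : nat) :
    epow E i.+1 -> E -> E :=
  if i is m.+1 return epow E i.+1 -> E -> E then
    fun (u : epow E m.+2) y =>
      let M1 z := Gamma (u ord0) (u (lift ord0 ord0)) z in
      if m == 0%N then M1 y else
        let u' : epow E m.+1 := [ffun l => u (widen_ord (leqnSn _) l)] in
        m.+1%:R^-1 *:
          (\sum_(l < m.+1)
             partial (fun w => connM Gamma w y) u' l (l.+1%:R *: u (lift ord0 l))
           + M1 (connM Gamma u' y))
  else fun _ y => y.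

Definition taylor (j : nat) (c : R -> E) : epow E j.+1 :=
  [ffun l : 'I_j.+1 => l`!%:R^-1 *: derive1n l c 0].

Definition zcoord (Gamma : E -> clin E (clin E E)) (c : R -> E) (i : nat) : E :=
  i%:R^-1 *:
    ((i.-1)`!%:R^-1 *: derive1n i c 0
     + \sum_(1 <= j < i)
         (i - j - 1)`!%:R^-1 *: connM Gamma (taylor j c) (derive1n (i - j) c 0)).

(* Phi^k in terms of a curve c in the model space *)
Definition curve_triv (k : nat) (Gamma : E -> clin E (clin E E)) (c : R -> E) :
    E * epow E k :=
  (c 0, [ffun l : 'I_k => if l == 0%N :> nat then derive1n 1 c 0 else zcoord Gamma c l.+1]).

(* Psi^k in terms of a curve c in the model space *)
Definition curve_chart (k : nat) (c : R -> E) : E * epow E k :=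
  (c 0, [ffun l : 'I_k => l.+1`!%:R^-1 *: derive1n l.+1 c 0]).

End LinearConnections.

Section Jets.
Context {R : realType} {E : normedModType R} {M I : Type}.
Variables (U : I -> set M) (psi : I -> M -> E) (k : nat).

(* The curves of C_x, as total functions g of which only the restriction to some
   ]-e, e[ matters *)
Definition curves (x : M) : set (R -> M) :=
  [set g | g 0 = x /\ exists2 e : R, 0 < e & forall a,
    let A : set R := `]- e, e[ `&` g @^-1` U a in
    open A /\ smooth_on (V := R^o) A (psi a \o g)].

Definition jet_equiv (x : M) (g1 g2 : R -> M) : Prop :=
  exists2 a, U a x & forall j, (1 <= j <= k)%N ->
    derive1n j (psi a \o g1) 0 = derive1n j (psi a \o g2) 0.

Definition jet_class (x : M) (g : R -> M) : set (R -> M) :=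
  curves x `&` jet_equiv x g.

(* T^k M, the disjoint union over x of the quotients of C_x by jet_equiv x *)
Record jet := Jet {
  jet_base : M ;
  jet_curves : set (R -> M) ;
  jetP : exists2 g, curves jet_base g & jet_curves = jet_class jet_base g }.

Definition jet_of (x : M) (g : R -> M) (hg : curves x g) : jet :=
  @Jet x (jet_class x g) (ex_intro2 _ _ g hg erefl).

Definition jet_repr (u : jet) : R -> M := s2val (cid2 (jetP u)).

Definition jet_dom (a : I) : set jet := jet_base @^-1` U a.

Definition jet_chart (a : I) (u : jet) : E * epow E k :=
  curve_chart k (psi a \o jet_repr u).

Definition jet_triv (Gamma : I -> E -> clin E (clin E E)) (a : I) (u : jet) :
    E * epow E k :=
  curve_triv k (Gamma a) (psi a \o jet_repr u).

End Jets.

Arguments jet_base {R E M I} U psi k _.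
Arguments jet_dom {R E M I} U psi k a.
Arguments jet_chart {R E M I} U psi k a u.
Arguments jet_triv {R E M I} U psi k Gamma a u.
Arguments jet_of {R E M I U psi} k {x g} hg.

(* Main.v *)
Require Import Defs.
From HB Require Import structures.
From mathcomp Require Import all_boot all_order all_algebra.
From mathcomp Require Import all_classical all_reals all_analysis.

Set Implicit Arguments.
Unset Strict Implicit.
Unset Printing Implicit Defensive.
Import Order.TTheory GRing.Theory Num.Theory.
Import numFieldNormedType.Exports.
Local Open Scope classical_set_scope.
Local Open Scope ring_scope.

(** Along a curve c in a chart, consider the covariant derivative
    D Y = Y' + Gamma(c, c')Y of a vector field Y along c. The recursion defining the
    local components M^i says that (j+1) M^(j+1) = (M^j)' + M^1 M^j along the Taylor
    coefficients of c, with M^0 = id. By induction on n this gives the Leibniz rule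

      D^n Y / n! = sum over j <= n of M^j Y^(n-j) / (n-j)!,

    and for Y = c' it identifies the fibre coordinate z^i with D^(i-1) c' / i!
    ([zcoord_covD]). The transformation law of a connection makes D commute with the
    differential h' of a transition map h, so that D^(i-1)(h o c)' = h'(c) D^(i-1)c'
    ([covD_natural]): in the coordinates z^i the change of chart acts by the
    differential of h on each factor, which is the formula for the change of
    trivialization ([curve_triv_transition]).

    It remains to compare these coordinates with the Taylor coefficients xi_i that
    are the charts of the manifold of jets. There z^i = xi_i + P_i(x, xi_1, ...,
    xi_{i-1}) with P_i smooth ([curve_triv_shear]), a triangular map with a smooth
    inverse ([smooth_unshear]). The change of Taylor coordinates between two charts is
    therefore the composition of a triangular map, the linear change of
    trivialization, and the inverse of a triangular map. This gives at once the
    independence of contact of order k from the chart, the smooth atlas of the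
    manifold of jets, and the smoothness of the trivializations in both directions.
    Surjectivity of the charts comes from polynomial curves ([polynomial_jet]).

    All of this rests on the calculus of maps of class C^n between normed spaces:
    the class is stable under sums, bilinear operations and composition
    ([Cn_bilin], [Cn_comp]), by induction on n over all spaces at once. *)

(** * Continuous linear and bilinear maps *)

Section BoundedLinear.
Context {R : realType}.
Implicit Types V W Z : normedModType R.

Lemma clin_norm_bound V W (f : clin V W) x : `|f x| <= `|f| * `|x|.
Proof.
have [->|x0] := eqVneq x 0; first by rewrite clin0 !normr0 mulr0.
have nx : 0 < `|x| by rewrite normr_gt0.
rewrite -ler_pdivrMr// mulrC -[X in X * _]ger0_norm ?invr_ge0// -normrZ -clinZ.
by apply: clin_norm_ge; rewrite normrZ normfV normr_id mulVf// gt_eqF.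
Qed.

Lemma clin_norm_leM V W (f : clin V W) c :
  0 <= c -> (forall x, `|f x| <= c * `|x|) -> `|f| <= c.
Proof.
move=> c0 fc; apply: clin_norm_le => x x1; apply: (le_trans (fc x)).
by rewrite ler_piMr.
Qed.

Lemma bounded_linear_clin V W (f : V -> W) : linear f ->
  (exists r, forall x, `|f x| <= r * `|x|) -> f \in @clin_pred R V W.
Proof.
move=> lf [r fr]; apply/asboolP; split=> //.
pose F : {linear V -> W} := HB.pack f (GRing.isLinear.Build R V W _ f lf).
change (continuous F); apply/linear_bounded_continuous/linear_boundedP.
near=> s => x; apply: (le_trans (fr x)); apply: ler_wpM2r => //.
Unshelve. all: by end_near. Qed.

(** The norm bound replaces continuity in every construction below: an estimate
    is what each construction provides. *)
Definition bounded_clin V W (f : V -> W) (lf : linear f)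
    (bf : exists r, forall x, `|f x| <= r * `|x|) : clin V W :=
  CLin (bounded_linear_clin lf bf).

Lemma clinE V W (f : V -> W) (lf : linear f) bf x : bounded_clin lf bf x = f x.
Proof. by []. Qed.

Lemma clinDl V W (f g : clin V W) x : (f + g) x = f x + g x.
Proof. by []. Qed.
Lemma clinZl V W a (f : clin V W) x : (a *: f) x = a *: f x.
Proof. by []. Qed.
Lemma clin_suml V W I (r : seq I) (P : pred I) (f : I -> clin V W) x :
  (\sum_(i <- r | P i) f i) x = \sum_(i <- r | P i) f i x.
Proof. exact: (big_morph (fun h : clin V W => h x)). Qed.
Lemma clinD V W (f : clin V W) x y : f (x + y) = f x + f y.
Proof. by rewrite -[x]scale1r clin_linear !scale1r. Qed.
Lemma clin_sum V W (f : clin V W) I (r : seq I) (P : pred I) (v : I -> V) :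
  f (\sum_(i <- r | P i) v i) = \sum_(i <- r | P i) f (v i).
Proof. exact: (big_morph f (clinD f) (clin0 f)). Qed.

Lemma clin_eq V W (f g : clin V W) : f =1 g -> f = g.
Proof. by move=> fg; apply/val_inj/funext. Qed.

Section Bilinear.
Variables (V W Z : normedModType R) (f : V -> W -> Z).
Hypotheses (fl : forall v, linear (f v)) (fr : forall w, linear (f ^~ w))
  (fb : exists r, forall v w, `|f v w| <= r * `|v| * `|w|).

Lemma bilin_bound1 v : exists r, forall w, `|f v w| <= r * `|w|.
Proof. by have [r h] := fb; exists (r * `|v|). Qed.

Lemma bilin_linear : linear (fun v => bounded_clin (fl v) (bilin_bound1 v)).
Proof. by move=> a u v; apply: clin_eq => w; exact: fr. Qed.

Lemma bilin_bound : exists r, forall v,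
  `|bounded_clin (fl v) (bilin_bound1 v)| <= r * `|v|.
Proof.
have [r h] := fb; exists `|r| => v; apply: clin_norm_leM; first exact: mulr_ge0.
move=> w; rewrite clinE (le_trans (h v w))//.
by rewrite ler_wpM2r// ler_wpM2r// ler_norm.
Qed.

(** Bilinear maps are curried, so that no norm on a product or a tensor product
    is involved and a bilinear map is itself an operator that can be composed. *)
Definition bounded_bilin : clin V (clin W Z) :=
  bounded_clin bilin_linear bilin_bound.

End Bilinear.

Section Compose.
Variables (V W Z : normedModType R).

Lemma comp_linear (g : clin W Z) (f : clin V W) : linear (fun v => g (f v)).
Proof. by move=> a u v; rewrite !clin_linear. Qed.

Lemma comp_bound1 (g : clin W Z) (f : clin V W) x :
  `|g (f x)| <= `|g| * `|f| * `|x|.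
Proof.
apply: (le_trans (clin_norm_bound _ _)); rewrite -mulrA ler_wpM2l//.
exact: clin_norm_bound.
Qed.

Definition clin_comp (g : clin W Z) (f : clin V W) : clin V Z :=
  bounded_clin (comp_linear g f) (ex_intro _ _ (comp_bound1 g f)).

Lemma clin_compl (g : clin W Z) : linear (clin_comp g).
Proof. by move=> a f h; apply: clin_eq => v; exact: clin_linear. Qed.

Lemma clin_compr (f : clin V W) : linear (clin_comp ^~ f).
Proof. by move=> a g h; apply: clin_eq. Qed.

Lemma clin_comp_bound g f : `|clin_comp g f| <= 1 * `|g| * `|f|.
Proof.
rewrite mul1r; apply: clin_norm_leM; first exact: mulr_ge0.
exact: comp_bound1.
Qed.

Definition comp_bilin : clin (clin W Z) (clin (clin V W) (clin V Z)) :=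
  bounded_bilin clin_compl clin_compr (ex_intro _ _ clin_comp_bound).

Lemma eval_linear (B : clin V (clin W Z)) (w : W) : linear (fun v => B v w).
Proof. by move=> a u v; rewrite clin_linear. Qed.

Lemma eval_bound (B : clin V (clin W Z)) v w : `|B v w| <= `|B| * `|w| * `|v|.
Proof.
rewrite mulrAC; apply: (le_trans (clin_norm_bound _ _)); rewrite ler_wpM2r//.
exact: clin_norm_bound.
Qed.

Lemma eval_bounded (B : clin V (clin W Z)) w :
  exists r, forall v, `|B v w| <= r * `|v|.
Proof. by exists (`|B| * `|w|) => v; exact: eval_bound. Qed.

Definition clin_flip_at (B : clin V (clin W Z)) (w : W) : clin V Z :=
  bounded_clin (eval_linear B w) (eval_bounded B w).

Lemma clin_flip_l B : linear (clin_flip_at B).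
Proof. by move=> a u v; apply: clin_eq => x; exact: clin_linear. Qed.
Lemma clin_flip_bound B w : `|clin_flip_at B w| <= `|B| * `|w|.
Proof. by apply: clin_norm_leM => [|v]; [exact: mulr_ge0|exact: eval_bound]. Qed.

Definition clin_flip (B : clin V (clin W Z)) : clin W (clin V Z) :=
  bounded_clin (clin_flip_l B) (ex_intro _ _ (clin_flip_bound B)).

Lemma clin_flip_linear : linear clin_flip.
Proof. by move=> a B B'; apply: clin_eq => w; apply: clin_eq. Qed.

Lemma clin_flip_bounded : exists r, forall B, `|clin_flip B| <= r * `|B|.
Proof.
by exists 1 => B; rewrite mul1r; apply: clin_norm_leM => // w; exact: clin_flip_bound.
Qed.

(** As an operator on bilinear maps, the exchange of arguments turns
    u |-> B(f'(u), g) into an expression that is again bilinear in (f', g); the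
    product rule can then be iterated, see [Cn_bilin]. *)
Definition flip_clin : clin (clin V (clin W Z)) (clin W (clin V Z)) :=
  bounded_clin clin_flip_linear clin_flip_bounded.

End Compose.

Lemma id_linear V : linear (id : V -> V). Proof. by []. Qed.
Lemma id_bound V : exists r, forall x : V, `|x| <= r * `|x|.
Proof. by exists 1 => x; rewrite mul1r. Qed.
Definition clin_id V : clin V V := bounded_clin (@id_linear V) (id_bound V).

Section Products.
Variables V W : normedModType R.
Lemma fst_linear : linear (fst : V * W -> V). Proof. by []. Qed.
Lemma snd_linear : linear (snd : V * W -> W). Proof. by []. Qed.
Lemma fst_bounded : exists r, forall p : V * W, `|p.1| <= r * `|p|.
Proof. by exists 1 => p; rewrite mul1r prod_normE le_max lexx. Qed.
Lemma snd_bounded : exists r, forall p : V * W, `|p.2| <= r * `|p|.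
Proof. by exists 1 => p; rewrite mul1r prod_normE le_max lexx orbT. Qed.
Definition fst_clin : clin (V * W)%type V := bounded_clin fst_linear fst_bounded.
Definition snd_clin : clin (V * W)%type W := bounded_clin snd_linear snd_bounded.

Lemma inl_linear : linear (fun v : V => (v, 0 : W)).
Proof. by move=> a u v; congr pair; rewrite /= scaler0 addr0. Qed.
Lemma inr_linear : linear (fun w : W => (0 : V, w)).
Proof. by move=> a u v; congr pair; rewrite /= scaler0 addr0. Qed.
Lemma inl_bounded : exists r, forall v : V, `|(v, 0 : W)| <= r * `|v|.
Proof. by exists 1 => v; rewrite mul1r prod_normE/= normr0 ge_max lexx/=. Qed.
Lemma inr_bounded : exists r, forall w : W, `|(0 : V, w)| <= r * `|w|.
Proof. by exists 1 => v; rewrite mul1r prod_normE/= normr0 ge_max lexx/= normr_ge0. Qed.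
Definition inl_clin : clin V (V * W)%type := bounded_clin inl_linear inl_bounded.
Definition inr_clin : clin W (V * W)%type := bounded_clin inr_linear inr_bounded.
End Products.

Definition eval_bilin V W : clin V (clin (clin V W) W) := clin_flip (clin_id (clin V W)).

Definition clin_lin V W (f : clin V W) : {linear V -> W} :=
  HB.pack (f : V -> W)
    (GRing.isLinear.Build R V W _ (f : V -> W) (@clin_linear R V W f)).

Lemma is_diff_clin V W (f : clin V W) x : is_diff x f f.
Proof.
have cf : continuous (clin_lin f) by exact: clin_continuous.
apply: DiffDef; first exact: (@linear_differentiable _ _ _ (clin_lin f)).
exact: (@diff_lin _ _ _ (clin_lin f)).
Qed.

Lemma diff_in_clin V W (f : V -> W) x : differentiable f x ->
  ('d f x : V -> W) \in @clin_pred R V W.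
Proof.
move=> df; apply/asboolP; split; last exact: diff_continuous.
by move=> a u v; rewrite linearP.
Qed.

Lemma diffLE V W (f : V -> W) x v : differentiable f x -> diffL f x v = 'd f x v.
Proof.
move=> df.
by rewrite /diffL /insubd (insubT (mem (@clin_pred R V W)) (diff_in_clin df)).
Qed.

Lemma is_diff_diffL V W (f : V -> W) x : differentiable f x -> is_diff x f (diffL f x).
Proof. by move=> df; apply: DiffDef => //; apply/funext => v; rewrite diffLE. Qed.

Lemma diffL_is_diff V W (f : V -> W) x (L : clin V W) : is_diff x f L -> diffL f x = L.
Proof. by move=> [df e]; apply: clin_eq => v; rewrite diffLE// e. Qed.

End BoundedLinear.

(** * Differentials and the classes C^n *)

Section Calculus.
Context {R : realType}.
Implicit Types U V W Z : normedModType R.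

(** Frechet differentiability without little-o notation. The
    differential being defined by choice among the linear maps that fit, a
    candidate has to be exhibited and identified with it by uniqueness. *)
Lemma is_diff_clinP V W (f : V -> W) x (L : clin V W) : is_diff x f L <->
  forall e : R, 0 < e ->
    \forall h \near (0 : V), `|f (h + x) - (f x + L h)| <= e * `|h|.
Proof.
split=> [[/diff_locally/eqaddoP fx fL] e e0|fe].
  by near do rewrite -fL; exact: fx.
have cL : continuous (clin_lin L) by exact: clin_continuous.
have fL : f \o shift x = cst (f x) + clin_lin L +o_ (0 : V) id.
  by apply/eqaddoP => e e0; exact: fe.
have dL := diff_unique cL fL.
by apply: DiffDef => //; apply/diff_locallyP; rewrite dL.
Unshelve. all: by end_near. Qed.

(** Differentiability is a property of germs; this is what allows maps that are
    only meaningful on an open set to be represented by total functions. *)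
Lemma is_diff_near_eq V W (f g : V -> W) x (L : clin V W) :
  (\forall y \near x, f y = g y) -> is_diff x f L -> is_diff x g L.
Proof.
move=> fg /is_diff_clinP fL; apply/is_diff_clinP => e e0.
have gx := nbhs_singleton fg.
have : \forall h \near (0 : V), f (h + x) = g (h + x).
  by rewrite (near_shift x) /= sub0r; near=> y; rewrite /= subrK; near: y.
move: (fL e e0); apply: filterS2 => h + fgh; by rewrite fgh gx.
Unshelve. all: by end_near. Qed.

Lemma diffL_near_eq V W (f g : V -> W) x :
  (\forall y \near x, f y = g y) -> differentiable f x ->
  differentiable g x /\ diffL g x = diffL f x.
Proof.
move=> fg df; have h := is_diff_near_eq fg (is_diff_diffL df).
by split; [exact: ex_diff|exact: diffL_is_diff].
Qed.

Lemma clinB V W (f : clin V W) x y : f (x - y) = f x - f y.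
Proof. by rewrite clinD -scaleN1r clinZ scaleN1r. Qed.

Lemma clinBl V W (f g : clin V W) x : (f - g) x = f x - g x.
Proof. by []. Qed.

(** The increment of a product, with both linear remainders isolated: each of the
    three terms has a factor that is small compared to the increment. *)
Lemma bilin_expand V W Z (B : clin V (clin W Z)) a a' b b' u w :
  B a' b' - (B a b + (B a w + B u b)) =
  B (a' - (a + u)) b' + B u (b' - b) + B a (b' - (b + w)).
Proof.
rewrite !clinB !clinBl !clinD !clinDl.
move: (B a' b') (B a b') (B u b') (B u b) (B a b) (B a w) => p q r s t v.
rewrite -!addrA; congr (_ + _).
by rewrite (addrA r) addrACA (addrC r) addKr -!opprD (addrC s) addrA.
Qed.

(** The differential of y |-> B(f(y), g(y)) where f and g have values a and b and
    differentials f' and g'. It is written with operators rather than as a lambda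
    abstraction so that it is visibly bilinear in the pairs (a, g') and (f', b). *)
Definition bilin_diff U V W Z (B : clin V (clin W Z)) (f' : clin U V)
    (g' : clin U W) a b : clin U Z :=
  comp_bilin U W Z (B a) g' + clin_flip_at (clin_comp B f') b.
Lemma bilin_diffE U V W Z (B : clin V (clin W Z)) (f' : clin U V)
    (g' : clin U W) a b h :
  bilin_diff B f' g' a b h = B a (g' h) + B (f' h) b.
Proof. by []. Qed.

Lemma is_diff_bilin U V W Z (B : clin V (clin W Z)) (f : U -> V) (g : U -> W)
    x (f' : clin U V) (g' : clin U W) :
  is_diff x f f' -> is_diff x g g' ->
  is_diff x (fun y => B (f y) (g y)) (bilin_diff B f' g' (f x) (g x)).
Proof.
move=> df dg; apply/is_diff_clinP => e e0.
(* C - 1 bounds the sum of the coefficients of the three remainders in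
   bilin_expand, once g (h + x) is within 1 of g x; the added 1 makes C > 0. *)
pose C := `|B| * (`|g x| + 1 + `|f'| + `|f x|) + 1.
have C0 : 0 < C.
  by apply: ltr_wpDl => //; apply: mulr_ge0 => //; rewrite !addr_ge0.
have d0 : 0 < e / C by rewrite divr_gt0.
have cg : g (h + x) @[h --> (0 : U)] --> g x.
  have /differentiable_continuous cg := @ex_diff _ _ _ _ _ _ _ dg.
  by move: (cg); rewrite /prop_for /continuous_at -{1}[x]add0r -cvg_comp_shift.
have /cvgrPdist_le cg1 := cg; have := cg1 1 ltr01; have := cg1 _ d0.
move: (iffLR (is_diff_clinP f x f') df _ d0) (iffLR (is_diff_clinP g x g') dg _ d0).
move=> {cg cg1} nf ng ngd ng1.
near=> h.
have hf : `|f (h + x) - (f x + f' h)| <= e / C * `|h| by near: h.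
have hg : `|g (h + x) - (g x + g' h)| <= e / C * `|h| by near: h.
have hd : `|g x - g (h + x)| <= e / C by near: h.
have h1 : `|g x - g (h + x)| <= 1 by near: h.
rewrite bilin_diffE bilin_expand.
apply: (@le_trans _ _ (e / C * `|h| * (C - 1))); last first.
  rewrite mulrAC ler_wpM2r// mulrAC ler_pdivrMr// ler_wpM2l ?(ltW e0)//.
  by rewrite lerBlDr lerDl.
have -> : C - 1 = `|B| * (`|g x| + 1 + `|f'| + `|f x|) by rewrite /C addrK.
have Bg : `|g (h + x)| <= `|g x| + 1.
  rewrite -[g (h + x)](subrK (g x)) addrC (le_trans (ler_normD _ _))//.
  by rewrite lerD2l distrC.
have Bb v w a b : `|v| <= a -> `|w| <= b -> `|B v w| <= `|B| * (a * b).
  move=> va wb; apply: (le_trans (eval_bound B v w)).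
  rewrite -mulrA ler_wpM2l// mulrC; exact: ler_pM.
move: (Bb _ _ _ _ hf Bg) => b1.
have b2 : `|B (f' h) (g (h + x) - g x)| <= `|B| * (`|f'| * `|h| * (e / C)).
  by apply: Bb; [exact: clin_norm_bound|rewrite distrC].
move: (Bb _ _ _ _ (lexx `|f x|) hg) => b3.
apply: (le_trans (ler_normD _ _)).
apply: (le_trans (lerD (ler_normD _ _) (lexx _))).
apply: (le_trans (lerD (lerD b1 b2) b3)).
rewrite le_eqVlt; apply/orP; left; apply/eqP.
move: (e / C) `|h| `|B| `|g x| `|f'| `|f x| => {}e' n b p q r.
rewrite -!mulrDr [RHS]mulrCA; congr (_ * _); rewrite !mulrDr mulr1.
by rewrite (mulrC r) [X in _ + X + _]mulrC mulrA [X in _ + X + _]mulrAC -mulrA.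
Unshelve. all: by end_near. Qed.

Lemma is_diffD_clin V W (f g : V -> W) x (f' g' : clin V W) :
  is_diff x f f' -> is_diff x g g' ->
  is_diff x (fun y => f y + g y) (f' + g' : clin V W).
Proof. by move=> df dg; exact: is_diffD. Qed.

Lemma is_diff_post V W Z (L : clin W Z) (f : V -> W) x (f' : clin V W) :
  is_diff x f f' -> is_diff x (fun y => L (f y)) (comp_bilin V W Z L f').
Proof. by move=> df; apply: is_diff_comp => //; exact: is_diff_clin. Qed.

Lemma is_diff_comp_clin V W Z (f : V -> W) (g : W -> Z) x (f' : clin V W)
    (g' : clin W Z) :
  is_diff x f f' -> is_diff (f x) g g' ->
  is_diff x (g \o f) (comp_bilin V W Z g' f').
Proof. by move=> df dg; exact: is_diff_comp. Qed.

(** [diffL f] is a total function of which only the values on A are under control,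
    so that the congruence rule is needed at every differentiation. *)
Lemma Cn_ext V n W (A : set V) (f g : V -> W) : open A ->
  (forall x, A x -> f x = g x) -> Cn n A f -> Cn n A g.
Proof.
move=> oA; elim: n W f g => [|n IH] W f g fg /=.
  move=> cf x Ax; have fgx : \forall y \near x, f y = g y.
    by apply: filterS (open_nbhs_nbhs (conj oA Ax)); exact: fg.
  rewrite /prop_for /continuous_at -(fg x Ax).
  exact: cvg_trans (near_eq_cvg fgx) (cf x Ax).
move=> [df cf]; have h x : A x -> differentiable g x /\ diffL g x = diffL f x.
  move=> Ax; apply: diffL_near_eq (df x Ax).
  by apply: filterS (open_nbhs_nbhs (conj oA Ax)); exact: fg.
split=> [x /h[]//|]; apply: IH cf => x Ax; by rewrite (h x Ax).2.
Qed.

Lemma Cn_sub V n W (A B : set V) (f : V -> W) : A `<=` B -> Cn n B f -> Cn n A f.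
Proof.
move=> AB; elim: n W f => [|n IH] W f /=; first by move=> cf x /AB; exact: cf.
by move=> [df cf]; split; [move=> x /AB; exact: df|exact: IH].
Qed.

Lemma CnS V n W (A : set V) (f : V -> W) : Cn n.+1 A f -> Cn n A f.
Proof.
elim: n W f => [|n IH] W f [df cf]; last by split=> //; exact: IH.
by move=> x Ax; exact/differentiable_continuous/df.
Qed.

Lemma Cn_cst V n W (A : set V) (w : W) : open A -> Cn n A (fun=> w).
Proof.
move=> oA; elim: n W w => [|n IH] W w /=.
  by move=> x _; exact: cst_continuous.
have dw (x : V) : is_diff x (fun=> w) (0 : clin V W) by exact: is_diff_cst.
split=> [x _|]; first by have [] := dw x.
apply: (@Cn_ext _ n _ A (fun=> 0)) => // x _.
by rewrite (diffL_is_diff (dw x)).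
Qed.

Lemma CnD V n W (A : set V) (f g : V -> W) : open A ->
  Cn n A f -> Cn n A g -> Cn n A (fun x => f x + g x).
Proof.
move=> oA; elim: n W f g => [|n IH] W f g.
  by move=> cf cg x Ax; apply: continuousD; [exact: cf|exact: cg].
move=> [df cf] [dg cg].
have d x : A x -> is_diff x (fun y => f y + g y) (diffL f x + diffL g x : clin V W).
  by move=> Ax; apply: is_diffD_clin; apply: is_diff_diffL; [exact: df|exact: dg].
split=> [x /d[]//|]; apply: Cn_ext (IH _ _ _ cf cg) => // x Ax.
by rewrite (diffL_is_diff (d x Ax)).
Qed.

(** By induction: the differential of L o f is the image of the differential of f
    under the continuous linear operator that composes with L. *)
Lemma Cn_post V n W Z (A : set V) (L : clin W Z) (f : V -> W) : open A ->
  Cn n A f -> Cn n A (fun x => L (f x)).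
Proof.
move=> oA; elim: n W Z L f => [|n IH] W Z L f.
  by move=> cf x Ax; apply: continuous_comp; [exact: cf|exact: clin_continuous].
move=> [df cf].
have d x : A x -> is_diff x (fun y => L (f y)) (comp_bilin V W Z L (diffL f x)).
  by move=> Ax; exact/is_diff_post/is_diff_diffL/df.
split=> [x /d[]//|].
apply: Cn_ext (IH _ _ (comp_bilin V W Z L) _ cf) => // x Ax.
by rewrite (diffL_is_diff (d x Ax)).
Qed.

(** The product rule expresses the differential as a sum of two bilinear
    expressions in (f, Dg) and (Df, g), to which the induction hypothesis applies
    because it is quantified over all spaces and all bilinear maps. *)
Lemma Cn_bilin U n V W Z (A : set U) (B : clin V (clin W Z)) (f : U -> V)
    (g : U -> W) : open A ->
  Cn n A f -> Cn n A g -> Cn n A (fun x => B (f x) (g x)).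
Proof.
move=> oA; elim: n V W Z B f g => [|n IH] V W Z B f g.
  (* B is jointly continuous because it is differentiable along the two
     projections of the product. *)
  move=> cf cg x Ax; have := is_diff_bilin B (is_diff_clin (fst_clin V W) (f x, g x))
    (is_diff_clin (snd_clin V W) (f x, g x)).
  move=> /(@ex_diff _ _ _ _ _ _ _)/differentiable_continuous cB.
  apply: (@continuous_comp _ _ _ (fun y => (f y, g y)) (fun p => B p.1 p.2)) => //.
  by apply: cvg_pair; [exact: cf|exact: cg].
move=> cf cg; have [df cf'] := cf; have [dg cg'] := cg.
have d x : A x -> is_diff x (fun y => B (f y) (g y))
    (bilin_diff B (diffL f x) (diffL g x) (f x) (g x)).
  move=> Ax; apply: is_diff_bilin; apply: is_diff_diffL; [exact: df|exact: dg].
split=> [x /d[]//|].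
pose B1 : clin V (clin (clin U W) (clin U Z)) := clin_comp (comp_bilin U W Z) B.
pose B2 : clin (clin U V) (clin W (clin U Z)) :=
  clin_comp (flip_clin U W Z) (comp_bilin U V (clin W Z) B).
apply: Cn_ext (CnD oA (IH _ _ _ B1 _ _ (CnS cf) cg')
                      (IH _ _ _ B2 _ _ cf' (CnS cg))) => // x Ax.
by rewrite (diffL_is_diff (d x Ax)).
Qed.

(** By induction on the order, the differential of g o f being the bilinear
    composition of Dg o f and Df. *)
Lemma Cn_comp V n W Z (A : set V) (B : set W) (f : V -> W) (g : W -> Z) :
  open A -> (forall x, A x -> B (f x)) ->
  Cn n A f -> Cn n B g -> Cn n A (fun x => g (f x)).
Proof.
move=> oA AB; elim: n Z g => [|n IH] Z g.
  move=> cf cg x Ax; apply: (@continuous_comp _ _ _ f g); first exact: cf.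
  exact/cg/AB.
move=> cf [dg cg]; have [df cf'] := cf.
have d x : A x -> is_diff x (fun y => g (f y))
    (comp_bilin V W Z (diffL g (f x)) (diffL f x)).
  move=> Ax; apply: is_diff_comp_clin; apply: is_diff_diffL; first exact: df.
  exact/dg/AB.
split=> [x /d[]//|].
apply: Cn_ext (Cn_bilin (comp_bilin V W Z) oA (IH _ _ (CnS cf) cg) cf') => // x Ax.
by rewrite (diffL_is_diff (d x Ax)).
Qed.

End Calculus.

(** * Smooth maps *)

Section Smooth.
Context {R : realType}.
Implicit Types U V W Z E : normedModType R.

Section Rules.
Variables (V : normedModType R) (A : set V).
Hypothesis oA : open A.

Lemma smooth_ext W (f g : V -> W) :
  (forall x, A x -> f x = g x) -> smooth_on A f -> smooth_on A g.
Proof. by move=> fg sf n; apply: Cn_ext (sf n). Qed.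

Lemma smooth_cst W (w : W) : smooth_on A (fun=> w).
Proof. by move=> n; exact: Cn_cst. Qed.

Lemma smooth_clin W (L : clin V W) : smooth_on A L.
Proof.
case=> [|n /=]; first by move=> x _; exact: clin_continuous.
split=> [x _|]; first by have [] := is_diff_clin L x.
apply: (Cn_ext oA _ (Cn_cst n (L : clin V W) oA)) => x _.
by rewrite (diffL_is_diff (is_diff_clin L x)).
Qed.

Lemma smoothD W (f g : V -> W) :
  smooth_on A f -> smooth_on A g -> smooth_on A (fun x => f x + g x).
Proof. by move=> sf sg n; exact: CnD. Qed.

Lemma smooth_post W Z (L : clin W Z) (f : V -> W) :
  smooth_on A f -> smooth_on A (fun x => L (f x)).
Proof. by move=> sf n; exact: Cn_post. Qed.

Lemma smoothZ W a (f : V -> W) : smooth_on A f -> smooth_on A (fun x => a *: f x).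
Proof. exact: (smooth_post (a *: clin_id W)). Qed.

Lemma smoothB W (f g : V -> W) :
  smooth_on A f -> smooth_on A g -> smooth_on A (fun x => f x - g x).
Proof.
move=> sf sg; apply: smooth_ext (smoothD sf (smoothZ (-1) sg)) => x _.
by rewrite scaleN1r.
Qed.

Lemma smooth_sum W I (r : seq I) (P : pred I) (f : I -> V -> W) :
  (forall i, P i -> smooth_on A (f i)) ->
  smooth_on A (fun x => \sum_(i <- r | P i) f i x).
Proof.
move=> sf; elim: r => [|i r IH].
  by apply: smooth_ext (smooth_cst (0 : W)) => x _; rewrite big_nil.
have [Pi|Pi] := boolP (P i); last first.
  by apply: smooth_ext IH => x _; rewrite big_cons (negbTE Pi).
by apply: smooth_ext (smoothD (sf i Pi) IH) => x _; rewrite big_cons Pi.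
Qed.

Lemma smooth_bilin W1 W2 Z (B : clin W1 (clin W2 Z)) (f : V -> W1) (g : V -> W2) :
  smooth_on A f -> smooth_on A g -> smooth_on A (fun x => B (f x) (g x)).
Proof. by move=> sf sg n; exact: Cn_bilin. Qed.

(** Evaluation is bilinear in the operator and the vector. *)
Lemma smooth_app W Z (L : V -> clin W Z) (g : V -> W) :
  smooth_on A L -> smooth_on A g -> smooth_on A (fun x => L x (g x)).
Proof. by move=> sL sg; apply: (smooth_bilin (eval_bilin W Z) sg sL). Qed.

Lemma smooth_comp W Z (B : set W) (f : V -> W) (g : W -> Z) :
  (forall x, A x -> B (f x)) ->
  smooth_on A f -> smooth_on B g -> smooth_on A (fun x => g (f x)).
Proof. by move=> AB sf sg n; exact: (Cn_comp oA AB). Qed.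

Lemma smooth_sub W (B : set V) (f : V -> W) :
  B `<=` A -> smooth_on A f -> smooth_on B f.
Proof. by move=> BA sf n; exact: Cn_sub (sf n). Qed.

Lemma smooth_differentiable W (f : V -> W) x :
  smooth_on A f -> A x -> differentiable f x.
Proof. by move=> /(_ 1)[df _] /df. Qed.

Lemma smooth_is_diff W (f : V -> W) x :
  smooth_on A f -> A x -> is_diff x f (diffL f x).
Proof. by move=> sf Ax; exact/is_diff_diffL/smooth_differentiable. Qed.

Lemma smooth_continuous W (f : V -> W) x :
  smooth_on A f -> A x -> {for x, continuous f}.
Proof. by move=> sf Ax; exact: (sf 0%N). Qed.

Lemma smooth_diffL W (f : V -> W) : smooth_on A f -> smooth_on A (diffL f).
Proof. by move=> sf n; have [] := sf n.+1. Qed.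

Lemma smooth_pair W Z (f : V -> W) (g : V -> Z) :
  smooth_on A f -> smooth_on A g -> smooth_on A (fun x => (f x, g x)).
Proof.
move=> sf sg; apply: smooth_ext (smoothD (smooth_post (inl_clin W Z) sf)
  (smooth_post (inr_clin W Z) sg)) => x _.
by congr pair; rewrite /= ?addr0 ?add0r.
Qed.

End Rules.

Section Coordinates.
Variables (E : normedModType R) (n : nat).

Lemma coord_linear (i : 'I_n) : linear (fun v : epow E n => v i).
Proof. by move=> a u v; rewrite !ffunE. Qed.
Lemma coord_bounded (i : 'I_n) : exists r, forall v : epow E n, `|v i| <= r * `|v|.
Proof. by exists 1 => v; rewrite mul1r; exact: epow_norm_ge. Qed.
Definition coord_clin (i : 'I_n) : clin (epow E n) E :=
  bounded_clin (coord_linear i) (coord_bounded i).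

Definition epow_single (i : 'I_n) (x : E) : epow E n :=
  [ffun j => if j == i then x else 0].

Lemma epow_norm_le (v : epow E n) c :
  0 <= c -> (forall i, `|v i| <= c) -> `|v| <= c.
Proof. by move=> c0 vc; apply/bigmax_leP; split=> // i _. Qed.

Lemma single_linear i : linear (epow_single i).
Proof.
move=> a u v; apply/ffunP => j; rewrite !ffunE.
by case: ifP => // _; rewrite scaler0 addr0.
Qed.
Lemma single_bounded i : exists r, forall x : E, `|epow_single i x| <= r * `|x|.
Proof.
exists 1 => x; rewrite mul1r; apply: epow_norm_le => // j; rewrite ffunE.
by case: ifP => // _; rewrite normr0.
Qed.
Definition single_clin i : clin E (epow E n) :=
  bounded_clin (single_linear i) (single_bounded i).

Lemma sum_single (v : 'I_n -> E) : \sum_i epow_single i (v i) = [ffun i => v i].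
Proof.
apply/ffunP => j; rewrite sum_ffunE ffunE (bigD1 j)//= ffunE eqxx.
rewrite big1 ?addr0// => i /negbTE ij; by rewrite ffunE eq_sym ij.
Qed.

(** A map into the power is the sum of its components, each carried by the
    inclusion of the corresponding factor. *)
Lemma smooth_ffun V (A : set V) (f : 'I_n -> V -> E) : open A ->
  (forall i, smooth_on A (f i)) ->
  smooth_on A (fun x => [ffun i => f i x] : epow E n).
Proof.
move=> oA sf; apply: (smooth_ext oA) (smooth_sum oA (index_enum 'I_n) (P := xpredT)
  (f := fun i x => single_clin i (f i x)) _).
  by move=> x _; exact: sum_single.
by move=> i _; exact: smooth_post.
Qed.

Lemma smooth_coord V (A : set V) (f : V -> epow E n) i : open A ->
  smooth_on A f -> smooth_on A (fun x => f x i).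
Proof. by move=> oA; exact: (smooth_post oA (coord_clin i)). Qed.

Lemma open_clin_preimage V W (L : clin V W) (O : set W) : open O -> open (L @^-1` O).
Proof. by move=> oO; apply: open_comp => // x _; exact: clin_continuous. Qed.

Lemma open_coord (O : set E) i : open O -> open [set u : epow E n | O (u i)].
Proof. exact: (@open_clin_preimage _ _ (coord_clin i)). Qed.

End Coordinates.

End Smooth.

(** * The local components of the connection map *)

Section ConnectionMap.
Context {R : realType} {E : normedModType R}.
Implicit Types (Gamma : E -> clin E (clin E E)).

Definition epow_init {n} (u : epow E n.+1) : epow E n :=
  [ffun l : 'I_n => u (widen_ord (leqnSn _) l)].

(** (xi_1, 2 xi_2, 3 xi_3, ...): when the xi_l are the Taylor coefficients of a
    curve, this is the velocity of the curve of lower order Taylor coefficients,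
    see [covD_expansion]. *)
Definition jet_shift {n} (u : epow E n.+1) : epow E n :=
  [ffun l : 'I_n => l.+1%:R *: u (lift ord0 l)].

(** The local components M^i as functions of (x, xi_1, ..., xi_i) with values in
    L(E, E). Taking the operator as the value makes the sum of the partial
    derivatives a single total derivative in the direction [jet_shift u], and
    starting from M^0 = id makes the recursion uniform: M^1 comes out of it as
    well. *)
Fixpoint connL Gamma (i : nat) : epow E i.+1 -> clin E E :=
  if i is m.+1 return epow E i.+1 -> clin E E then
    fun u => m.+1%:R^-1 *:
      (diffL (connL Gamma (i := m)) (epow_init u) (jet_shift u)
       + clin_comp (Gamma (u ord0) (u (lift ord0 ord0))) (connL Gamma (epow_init u)))
  else fun=> clin_id E.
Arguments connL Gamma i : clear implicits.

Lemma connLS Gamma m u : connL Gamma m.+1 u =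
  m.+1%:R^-1 *: (diffL (connL Gamma m) (epow_init u) (jet_shift u)
       + clin_comp (Gamma (u ord0) (u (lift ord0 ord0))) (connL Gamma m (epow_init u))).
Proof. by []. Qed.

Variables (Gamma : E -> clin E (clin E E)) (O : set E).
Hypotheses (oO : open O) (sG : smooth_on O Gamma).

Definition fibre_over n : set (epow E n.+1) := [set u | O (u ord0)].

Lemma open_fibre_over n : open (@fibre_over n).
Proof. exact: open_coord. Qed.

Lemma epow_init0 n (u : epow E n.+2) : epow_init u ord0 = u ord0.
Proof. by rewrite ffunE; congr (u _); exact: val_inj. Qed.

Lemma smooth_connL i : smooth_on (@fibre_over i) (connL Gamma i).
Proof.
elim: i => [|m IH]; first exact/smooth_cst/open_fibre_over.
have oF := @open_fibre_over m.+1; have sc l := smooth_clin oF (coord_clin E l).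
have s0 : smooth_on (@fibre_over m.+1) (@epow_init m.+1).
  by apply: smooth_ffun => // l; exact: sc.
have s1 : smooth_on (@fibre_over m.+1) (@jet_shift m.+1).
  by apply: smooth_ffun => // l; apply: smoothZ => //; exact: sc.
have F0 (u : epow E m.+2) : fibre_over u -> fibre_over (epow_init u).
  by rewrite /fibre_over /= epow_init0.
apply: (smoothZ oF); apply: (smoothD oF).
  apply: (smooth_app oF) s1.
  apply: (smooth_comp oF F0 s0); apply: smooth_diffL IH.
apply: (smooth_bilin oF (comp_bilin E E E)).
  apply: (smooth_app oF) (sc _).
  by apply: (smooth_comp (B := O) (f := coord_clin E ord0) oF _ (sc ord0) sG).
exact: (smooth_comp oF F0 s0 IH).
Qed.

Lemma insertion_is_diff n (u : epow E n) l x :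
  is_diff x (fun w => [ffun j => if j == l then w else u j] : epow E n)
    (single_clin E l).
Proof.
have -> : (fun w => [ffun j => if j == l then w else u j] : epow E n) =
    (fun w => (u - single_clin E l (u l)) + single_clin E l w).
  apply/funext => w; apply/ffunP => j; rewrite !ffunE.
  by case: eqP => [->|_]; rewrite ?subrr ?add0r// subr0 addr0.
have d0 : is_diff x (cst (u - single_clin E l (u l))) (0 : clin E (epow E n)).
  exact: is_diff_cst.
by have := is_diffD_clin d0 (is_diff_clin (single_clin E l) x); rewrite add0r.
Qed.

(** A partial derivative is the directional derivative along a line, so it is the
    total derivative in the direction of one factor. The line may leave the domain
    of smoothness when it moves x, so the comparison holds near the base point only. *)
Lemma partial_connL m y (u : epow E m.+1) l v : fibre_over u ->
  (forall w, fibre_over w -> connM Gamma w y = connL Gamma m w y) ->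
  partial (fun w => connM Gamma w y) u l v =
  diffL (connL Gamma m) u (epow_single l v) y.
Proof.
move=> Ou ML; rewrite /partial.
pose f w := [ffun j => if j == l then w else u j] : epow E m.+1.
have fu : f (u l) = u by apply/ffunP => j; rewrite ffunE; case: eqP => [->|].
have df := insertion_is_diff u l (u l).
have Of : \forall w \near u l, fibre_over (f w).
  have /differentiable_continuous cf := @ex_diff _ _ _ _ _ _ _ df.
  have nF : nbhs (f (u l)) (@fibre_over m).
    by rewrite fu; apply: open_nbhs_nbhs; split=> //; exact: open_fibre_over.
  exact: cf nF.
have dC : is_diff (f (u l)) (connL Gamma m) (diffL (connL Gamma m) (f (u l))).
  by apply: (smooth_is_diff (smooth_connL m)); rewrite fu.
have dg := is_diff_post (clin_flip_at (clin_id (clin E E)) y) (is_diff_comp_clin df dC).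
rewrite (near_eq_derive (g := fun w => connL Gamma m (f w) y)); last first.
  by apply: filterS Of => w; exact: ML.
rewrite deriveE; last exact: (@ex_diff _ _ _ _ _ _ _ dg).
by rewrite (@diff_val _ _ _ _ _ _ _ dg) /= fu.
Qed.

(** The l-th partial derivatives add up to the total derivative in the direction
    with components (l+1) xi_{l+1}, l = 0, ..., i-1, counting x as the variable 0. *)
Lemma connM_connL i (u : epow E i.+1) y : fibre_over u ->
  connM Gamma u y = connL Gamma i u y.
Proof.
elim: i u y => [|m IH] u y Ou; first by [].
case: m IH u Ou => [|m] IH u Ou.
  rewrite connLS invr1 scale1r clinDl.
  have -> : diffL (connL Gamma 0) (epow_init u) = 0.
    have h : is_diff (epow_init u) (connL Gamma 0) (0 : clin (epow E 1) (clin E E)).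
      exact: is_diff_cst.
    exact: diffL_is_diff h.
  by rewrite add0r.
rewrite connLS clinZl clinDl.
rewrite [LHS]/=; congr (_ *: (_ + _)).
  have Ou' : fibre_over (epow_init u) by rewrite /fibre_over /= epow_init0.
  rewrite (eq_bigr (fun l => diffL (connL Gamma m.+1) (epow_init u)
      (epow_single l (l.+1%:R *: u (lift ord0 l))) y)); last first.
    by move=> l _; apply: partial_connL => // w Ow; exact: IH.
  by rewrite -clin_suml -clin_sum sum_single.
rewrite -[in LHS]/(epow_init u); congr (Gamma _ _ _).
by rewrite -IH// /fibre_over /= epow_init0.
Qed.

End ConnectionMap.

(** * Smooth curves *)

Section Curves.
Context {R : realType}.
Implicit Types E F W Z : normedModType R.

Lemma derive1_is_diff W (f : R^o -> W) (t : R^o) (L : clin R^o W) :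
  is_diff t f L -> derive1 (f : R -> W) t = L 1.
Proof. by move=> df; rewrite derive1E' ?diff_val//; exact: (@ex_diff _ _ _ _ _ _ _ df). Qed.

Lemma derive1_eq_on W (A : set R) (f g : R -> W) t : open A ->
  (forall s, A s -> f s = g s) -> A t -> derive1 f t = derive1 g t.
Proof.
move=> oA fg At; rewrite !derive1E; apply: near_eq_derive.
by apply: filterS (open_nbhs_nbhs (conj oA At)); exact: fg.
Qed.

Lemma derive1n_eq_on W n (A : set R) (f g : R -> W) t : open A ->
  (forall s, A s -> f s = g s) -> A t -> derive1n n f t = derive1n n g t.
Proof.
move=> oA fg; elim: n t => [|n IH] t At; first exact: fg.
by rewrite !derive1nS; exact: (derive1_eq_on oA).
Qed.

Section Rules.
Variable A : set R^o.
Hypothesis oA : open A.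

Lemma derive1_diffL W (f : R^o -> W) t : smooth_on A f -> A t ->
  derive1 (f : R -> W) t = diffL f t 1.
Proof. by move=> sf At; exact/derive1_is_diff/(smooth_is_diff sf). Qed.

Lemma smooth_derive1 W (f : R^o -> W) : smooth_on A f ->
  smooth_on A (derive1 (f : R -> W) : R^o -> W).
Proof.
move=> sf; apply: (smooth_ext oA) (smooth_post oA
  (clin_flip_at (clin_id (clin R^o W)) (1 : R^o)) (smooth_diffL sf)).
by move=> t At; rewrite (derive1_diffL sf At).
Qed.

Lemma smooth_derive1n W n (f : R^o -> W) : smooth_on A f ->
  smooth_on A (derive1n n (f : R -> W) : R^o -> W).
Proof.
move=> sf; elim: n => [//|n IH]; rewrite derive1nS; exact: smooth_derive1.
Qed.

Lemma derive1_comp_on W Z (B : set W) (f : R^o -> W) (g : W -> Z) t :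
  smooth_on A f -> smooth_on B g -> A t -> B (f t) ->
  derive1 (fun s : R => g (f s)) t = diffL g (f t) (derive1 (f : R -> W) t).
Proof.
move=> sf sg At Bt; rewrite (derive1_diffL sf At).
have h := is_diff_comp_clin (smooth_is_diff sf At) (smooth_is_diff sg Bt).
exact: (derive1_is_diff h).
Qed.

Lemma derive1_bilin W1 W2 Z (B : clin W1 (clin W2 Z)) (f : R^o -> W1)
    (g : R^o -> W2) t : smooth_on A f -> smooth_on A g -> A t ->
  derive1 (fun s : R => B (f s) (g s)) t =
  B (derive1 (f : R -> W1) t) (g t) + B (f t) (derive1 (g : R -> W2) t).
Proof.
move=> sf sg At; rewrite (derive1_diffL sf At) (derive1_diffL sg At) addrC.
exact: (derive1_is_diff (is_diff_bilin B (smooth_is_diff sf At) (smooth_is_diff sg At))).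
Qed.

Lemma derive1_app W Z (L : R^o -> clin W Z) (g : R^o -> W) t :
  smooth_on A L -> smooth_on A g -> A t ->
  derive1 (fun s : R => L s (g s)) t =
  derive1 (L : R -> clin W Z) t (g t) + L t (derive1 (g : R -> W) t).
Proof.
move=> sL sg At.
by rewrite (derive1_bilin (eval_bilin W Z) sg sL At) addrC.
Qed.

Lemma derive1_post W Z (L : clin W Z) (f : R^o -> W) t :
  smooth_on A f -> A t ->
  derive1 (fun s : R => L (f s)) t = L (derive1 (f : R -> W) t).
Proof.
move=> sf At; rewrite (derive1_diffL sf At).
exact: (derive1_is_diff (is_diff_post L (smooth_is_diff sf At))).
Qed.

Lemma derive1_scale W a (f : R^o -> W) t : smooth_on A f -> A t ->
  derive1 (fun s : R => a *: f s) t = a *: derive1 (f : R -> W) t.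
Proof. exact: (derive1_post (a *: clin_id W)). Qed.

Lemma derive1_add W (f g : R^o -> W) t :
  smooth_on A f -> smooth_on A g -> A t ->
  derive1 (fun s : R => f s + g s) t =
  derive1 (f : R -> W) t + derive1 (g : R -> W) t.
Proof.
move=> sf sg At; rewrite (derive1_diffL sf At) (derive1_diffL sg At).
exact: (derive1_is_diff (is_diffD_clin (smooth_is_diff sf At) (smooth_is_diff sg At))).
Qed.

Lemma derive1_sum_ord W n (f : 'I_n -> R^o -> W) t :
  (forall i, smooth_on A (f i)) -> A t ->
  derive1 (fun s : R => \sum_i f i s) t = \sum_i derive1 (f i : R -> W) t.
Proof.
move=> sf At; have h (r : seq 'I_n) :
    derive1 (fun s : R => \sum_(i <- r) f i s) t =
    \sum_(i <- r) derive1 (f i : R -> W) t.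
  elim: r => [|i r IH].
    rewrite big_nil; under eq_fun do rewrite big_nil.
    by rewrite derive1_cst.
  rewrite big_cons -IH; under eq_fun do rewrite big_cons.
  by apply: derive1_add => //; apply: smooth_sum.
exact: h.
Qed.

Lemma derive1_ffun W n (f : 'I_n -> R^o -> W) t :
  (forall i, smooth_on A (f i)) -> A t ->
  derive1 (fun s : R => [ffun i => f i s] : epow W n) t =
  [ffun i => derive1 (f i : R -> W) t].
Proof.
move=> sf At; apply/ffunP => i; rewrite ffunE.
rewrite -[LHS]/(coord_clin W i _) -(derive1_post (coord_clin W i) _ At).
  by congr derive1; apply/funext => s; rewrite /= ffunE.
exact: smooth_ffun.
Qed.

End Rules.

End Curves.

(** * Iterated covariant derivatives along a curve *)

Section CovariantDerivative.
Context {R : realType} {E : normedModType R}.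
Implicit Types (Gamma : E -> clin E (clin E E)) (c : R -> E).

(** [covD n] is the n-th iterate of Y |-> Y' + Gamma(c, c')Y applied to the velocity
    c'. *)
Fixpoint covD Gamma c (n : nat) : R -> E :=
  if n is m.+1 then
    fun t => derive1 (covD Gamma c m) t + Gamma (c t) (derive1 c t) (covD Gamma c m t)
  else derive1 c.

Lemma smooth_covD Gamma (O : set E) (A : set R^o) (c : R^o -> E) n : open A ->
  smooth_on O Gamma -> smooth_on A c -> (forall t, A t -> O (c t)) ->
  smooth_on A (covD Gamma c n : R^o -> E).
Proof.
move=> oA sG sc cO; have sc' := smooth_derive1 oA sc.
elim: n => [|n IH] //=; apply: (smoothD oA); first exact: smooth_derive1.
apply: (smooth_app oA) IH; apply: (smooth_app oA) sc'.
exact: (smooth_comp oA cO sc sG).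
Qed.

(** Differentiating dh(c) Y gives d^2h(c)(c', Y) + dh(c) Y'; the transformation law
    of the connection is exactly what absorbs the second order term. *)
Lemma covD_natural Gamma Gamma' (O : set E) (h : E -> E) (A : set R^o)
    (c c' : R^o -> E) n t :
  smooth_on O h -> smooth_on O Gamma ->
  (forall x xi y, O x -> diffL h x (Gamma x xi y) =
      diffL (diffL h) x xi y + Gamma' (h x) (diffL h x xi) (diffL h x y)) ->
  open A -> smooth_on A c -> (forall s, A s -> O (c s)) ->
  (forall s, A s -> c' s = h (c s)) -> A t ->
  covD Gamma' c' n t = diffL h (c t) (covD Gamma c n t).
Proof.
move=> sh sG hG oA sc cO c'h.
have dc' s : A s -> derive1 (c' : R -> E) s = diffL h (c s) (derive1 (c : R -> E) s).
  move=> As; rewrite (derive1_eq_on oA c'h As).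
  exact: (derive1_comp_on sc sh As (cO _ As)).
have sdh : smooth_on A (fun s : R^o => diffL h (c s)).
  exact: (smooth_comp oA cO sc (smooth_diffL sh)).
elim: n t => [|n IH] t At; first exact: dc'.
rewrite [LHS]/= (derive1_eq_on oA IH At).
rewrite (derive1_app sdh (smooth_covD n oA sG sc cO) At).
rewrite (derive1_comp_on sc (smooth_diffL sh) At (cO _ At)).
rewrite dc'// IH// c'h// /= clinD hG; last exact: cO.
by rewrite addrAC addrC.
Qed.

Definition taylor_at (j : nat) c (t : R) : epow E j.+1 :=
  [ffun l : 'I_j.+1 => l`!%:R^-1 *: derive1n l c t].

(** Each term of index (j, n+1-j) receives the weight j from the first sum and
    n+1-j from the second. *)
Lemma convolution_step (f : nat -> nat -> E) n :
  \sum_(j < n.+1) j.+1%:R *: f j.+1 (n - j)%N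
  + \sum_(j < n.+1) (n - j).+1%:R *: f j (n - j).+1 =
  n.+1%:R *: \sum_(j < n.+2) f j (n.+1 - j)%N :> E.
Proof.
rewrite scaler_sumr [RHS](eq_bigr (fun j : 'I_n.+2 => j%:R *: f j (n.+1 - j)%N
   + (n.+1 - j)%:R *: f j (n.+1 - j)%N)); last first.
  by move=> j _; rewrite -scalerDl -natrD subnKC// -ltnS.
rewrite big_split/=; congr (_ + _).
  by rewrite [RHS]big_ord_recl/= scale0r add0r.
rewrite [RHS]big_ord_recr/= subnn scale0r addr0; apply: eq_bigr => j _.
by rewrite subSn// -ltnS.
Qed.

Section Expansion.
Variables (Gamma : E -> clin E (clin E E)) (O : set E) (A : set R^o) (c : R^o -> E).
Hypotheses (oO : open O) (sG : smooth_on O Gamma) (oA : open A)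
  (sc : smooth_on A c) (cO : forall t, A t -> O (c t)).

(* X j is M^j along the curve, d i the coefficient c^(i+1) / i!, and y n the sum
   that will turn out to be the n-th covariant derivative divided by n!. *)
Let X j (t : R^o) := connL Gamma (taylor_at j c t).
Let d i (t : R^o) : E := i`!%:R^-1 *: derive1n i.+1 (c : R -> E) t.
Let y n (t : R^o) : E := \sum_(j < n.+1) X j t (d (n - j) t).

Lemma fact_invS n : n.+1%:R * (n.+1)`!%:R^-1 = n`!%:R^-1 :> R.
Proof. by rewrite factS natrM invfM mulrA divff ?mul1r// pnatr_eq0. Qed.

Let sd i : smooth_on A (d i).
Proof. by apply: smoothZ => //; exact: smooth_derive1n. Qed.

Let d' i t : A t -> derive1 (d i : R -> E) t = i.+1%:R *: d i.+1 t.
Proof.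
move=> At; rewrite /d (derive1_scale _ (smooth_derive1n oA i.+1 sc) At).
by rewrite scalerA fact_invS -derive1nS.
Qed.

Let taylor_over j t : A t -> fibre_over O (taylor_at j c t).
Proof. by move=> At; rewrite /fibre_over /= ffunE fact0 invr1 scale1r; exact: cO. Qed.

Let sT j : smooth_on A (taylor_at j c : R^o -> _).
Proof.
apply: smooth_ffun => // l; apply: smoothZ => //; exact: smooth_derive1n.
Qed.

Let sX j : smooth_on A (X j).
Proof. exact: (smooth_comp oA (@taylor_over j) (sT j) (smooth_connL oO sG j)). Qed.

Let T' j t : A t -> derive1 (taylor_at j c) t = jet_shift (taylor_at j.+1 c t).
Proof.
move=> At.
rewrite (derive1_ffun oA
  (f := fun (l : 'I_j.+1) s => l`!%:R^-1 *: derive1n l (c : R -> E) s)) //.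
  apply/ffunP => l; rewrite !ffunE scalerA [lift _ _ : nat]/= /bump /= add1n fact_invS.
  by rewrite (derive1_scale _ (smooth_derive1n oA l sc) At).
by move=> l; apply: smoothZ => //; exact: smooth_derive1n.
Qed.

Lemma epow_init_taylor j t : epow_init (taylor_at j.+1 c t) = taylor_at j c t.
Proof. by apply/ffunP => l; rewrite !ffunE. Qed.

(* The recursion defining M^(j+1) says that (j+1) M^(j+1) is the covariant
   derivative of M^j along a curve, the shift being the velocity of the Taylor
   coefficients. *)
Let X' j t : A t -> j.+1%:R *: X j.+1 t =
  derive1 (X j : R -> clin E E) t +
  clin_comp (Gamma (c t) (derive1 (c : R -> E) t)) (X j t).
Proof.
move=> At; rewrite /X connLS scalerA divff ?pnatr_eq0// scale1r.
rewrite epow_init_taylor -T'// !ffunE fact0 invr1 !scale1r.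
by rewrite (derive1_comp_on (sT j) (smooth_connL oO sG j) At (taylor_over _ At)).
Qed.

Let sXd j i : smooth_on A (fun t => X j t (d i t)).
Proof. exact: smooth_app. Qed.

Let y' n t : A t -> n.+1%:R *: y n.+1 t =
  derive1 (y n : R -> E) t + Gamma (c t) (derive1 (c : R -> E) t) (y n t).
Proof.
move=> At; rewrite /y (derive1_sum_ord oA (fun j : 'I_n.+1 => sXd j (n - j)) At).
rewrite clin_sum -big_split/=.
rewrite (eq_bigr (fun j : 'I_n.+1 => j.+1%:R *: X j.+1 t (d (n - j) t)
   + (n - j).+1%:R *: X j t (d (n - j).+1 t))); last first.
  move=> j _; rewrite (derive1_app (sX j) (sd _) At) d'// clinZ.
  by rewrite -(clinZl _ (X j.+1 t)) X'// clinDl addrAC.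
by rewrite big_split; exact: esym (convolution_step (fun j i => X j t (d i t)) n).
Qed.

(** The iterated covariant derivative follows a Leibniz rule in which M^j plays the
    part of the j-th divided derivative of the identity. *)
Lemma covD_expansion n t : A t -> covD Gamma c n t = n`!%:R *: y n t.
Proof.
elim: n t => [|n IH] t At.
  by rewrite /y big_ord1 /X /d /= subnn fact0 invr1 !scale1r.
rewrite [LHS]/= (derive1_eq_on oA IH At) IH// clinZ.
rewrite (derive1_scale _ _ At); last by apply: smooth_sum => // j _.
by rewrite -scalerDr -y'// scalerA -natrM mulnC -factS.
Qed.

(** The fibre coordinate z^(n+1) of a jet is the n-th covariant derivative of the
    velocity, divided by (n+1)!; this is where its naturality comes from. *)
Lemma zcoord_covD n : A 0 -> zcoord Gamma c n.+1 = (n.+1)`!%:R^-1 *: covD Gamma c n 0.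
Proof.
move=> A0; rewrite covD_expansion// scalerA factS natrM invfM mulrAC.
rewrite mulfK ?pnatr_eq0 -?lt0n ?fact_gt0//.
rewrite /zcoord; congr (_ *: _).
rewrite /y big_ord_recl subn0; congr (_ + _).
rewrite big_add1 big_mkord; apply: eq_bigr => j _.
have -> : X (lift ord0 j) = X j.+1 by [].
have -> : (n - lift ord0 j)%N = (n - j.+1)%N by [].
have -> : (n.+1 - j.+1)%N = (n - j.+1).+1 by rewrite subSS subnSK.
rewrite (connM_connL oO sG); last exact: (taylor_over _ A0).
by rewrite -clinZ subn1.
Qed.

End Expansion.

End CovariantDerivative.

(** * Triangular maps *)

Section Shear.
Context {R : realType} {E : normedModType R} (k : nat).
Variable (P : E * epow E k -> epow E k).
Hypothesis lowP : forall x (v w : epow E k) (l : 'I_k),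
  (forall m : 'I_k, (m < l)%N -> v m = w m) -> P (x, v) l = P (x, w) l.

Definition shear (p : E * epow E k) : E * epow E k := (p.1, p.2 + P p).

(** Fixed-point iteration for v = z - P(x, v). As P is strictly lower triangular,
    each step makes one more coordinate correct, whatever the starting point, so
    that k steps reach the solution by a smooth formula. *)
Fixpoint unshear_iter n (p : E * epow E k) : epow E k :=
  if n is m.+1 then p.2 - P (p.1, unshear_iter m p) else 0.

Definition unshear p : E * epow E k := (p.1, unshear_iter k p).

Lemma unshear_iter_shear n p (l : 'I_k) : (l < n)%N ->
  unshear_iter n (shear p) l = p.2 l.
Proof.
elim: n l => [//|n IH] l ln; rewrite /= !ffunE.
rewrite (@lowP _ _ p.2); first by rewrite -surjective_pairing addrK.
by move=> m ml; apply: IH; exact: leq_trans ml _.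
Qed.

Lemma shearK : cancel shear unshear.
Proof.
move=> p; rewrite [RHS]surjective_pairing; congr pair.
by apply/ffunP => l; apply: unshear_iter_shear.
Qed.

(** The coordinates below n do not change from the n-th iterate on, since each
    depends on the preceding ones only. *)
Lemma unshear_iter_stable n p (l : 'I_k) : (l < n)%N ->
  unshear_iter n.+1 p l = unshear_iter n p l.
Proof.
elim: n l => [//|n IH] l ln; rewrite [LHS]ffunE [RHS]ffunE; congr (_ + _).
rewrite !ffunE; congr (- _); apply: lowP => m ml.
by apply: IH; exact: leq_trans ml _.
Qed.

Lemma unshearK : cancel unshear shear.
Proof.
move=> p; rewrite [RHS]surjective_pairing; congr pair.
have e : unshear_iter k p = p.2 - P (unshear p).
  by apply/ffunP => l; rewrite -unshear_iter_stable.
by rewrite /= {1}e subrK.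
Qed.

Variable (D : set (E * epow E k)).
Hypotheses (oD : open D) (sP : smooth_on D P)
  (Dfst : forall x v w, D (x, v) -> D (x, w)).

Lemma smooth_shear : smooth_on D shear.
Proof.
apply: smooth_pair => //; first exact: (smooth_clin oD (fst_clin E (epow E k))).
by apply: smoothD => //; exact: (smooth_clin oD (snd_clin E (epow E k))).
Qed.

Lemma smooth_unshear : smooth_on D unshear.
Proof.
have s1 := smooth_clin oD (fst_clin E (epow E k)).
have s2 := smooth_clin oD (snd_clin E (epow E k)).
apply: (smooth_pair oD s1).
suff sI n : smooth_on D (unshear_iter n) by exact: sI.
elim: n => [|n IH] /=; first exact: smooth_cst.
apply: smoothB => //; apply: (smooth_comp oD _ (smooth_pair oD s1 IH) sP).
by case=> x v; exact: Dfst.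
Qed.

End Shear.

Section Triangular.
Context {R : realType} {E : normedModType R} (k : nat).
Variables (Gamma : E -> clin E (clin E E)) (O : set E).
Hypotheses (oO : open O) (sG : smooth_on O Gamma).

Definition jet_dom_model : set (E * epow E k) := [set p | O p.1].

Lemma open_jet_dom_model : open jet_dom_model.
Proof. exact: (@open_clin_preimage _ _ _ (fst_clin E (epow E k))). Qed.

(** The list (x, xi_1, ..., xi_k) indexed by natural numbers, with value 0 beyond k;
    this avoids casts between the finite index sets of the various orders. *)
Definition jet_entry (p : E * epow E k) (m : nat) : E :=
  if m is l.+1 then oapp p.2 0 (insub l) else p.1.

Definition jet_trunc j p : epow E j.+1 := [ffun l : 'I_j.+1 => jet_entry p l].

(** The terms of z^i that involve only Taylor coefficients of order less than i,
    in terms of these coefficients: c^(i-j) / (i-j-1)! is (i-j) times the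
    coefficient of order i-j. *)
Definition lower_part (p : E * epow E k) : epow E k :=
  [ffun l : 'I_k => l.+1%:R^-1 *: \sum_(1 <= j < l.+1)
     (l.+1 - j)%:R *: connL Gamma (jet_trunc j p) (jet_entry p (l.+1 - j))].

Lemma lower_part_low x (v w : epow E k) (l : 'I_k) :
  (forall m : 'I_k, (m < l)%N -> v m = w m) ->
  lower_part (x, v) l = lower_part (x, w) l.
Proof.
move=> vw; rewrite !ffunE; congr (_ *: _).
have ent m : (m <= l)%N -> jet_entry (x, v) m = jet_entry (x, w) m.
  case: m => [//|m] ml /=; case: insubP => //= i _ im.
  by apply: vw; rewrite im.
rewrite !big_nat; apply: eq_bigr => j /andP[j1 jl].
congr (_ *: _); rewrite ent; last by rewrite leq_subLR -addn1 addnC leq_add2r.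
congr (connL Gamma _ _); apply/ffunP => i; rewrite !ffunE; apply: ent.
by rewrite -ltnS (leq_trans (ltn_ord i)).
Qed.

Lemma smooth_jet_entry m : smooth_on jet_dom_model (jet_entry ^~ m).
Proof.
have oD := open_jet_dom_model.
case: m => [|m] /=; first exact: (smooth_clin oD (fst_clin E (epow E k))).
case: insubP => /= [i _ _|_]; last exact: smooth_cst.
exact: (smooth_coord i oD (smooth_clin oD (snd_clin E (epow E k)))).
Qed.

Lemma smooth_lower_part : smooth_on jet_dom_model lower_part.
Proof.
have oD := open_jet_dom_model.
apply: smooth_ffun => // l; apply: smoothZ => //; apply: smooth_sum => // j _.
apply: smoothZ => //; apply: (smooth_app oD) (smooth_jet_entry _).
apply: (smooth_comp oD _ _ (smooth_connL oO sG j)).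
  by move=> p Dp; rewrite /fibre_over /= ffunE.
by apply: smooth_ffun => // i; exact: smooth_jet_entry.
Qed.

(** In the Taylor coordinates the trivialization adds to xi_i an expression in
    x, xi_1, ..., xi_{i-1}, hence is invertible with a smooth inverse. *)
Lemma curve_triv_shear (c : R -> E) : O (c 0) ->
  curve_triv k Gamma c = shear lower_part (curve_chart k c).
Proof.
move=> Oc; congr pair; apply/ffunP => l; rewrite 3!ffunE.
have ent m : (m <= k)%N -> jet_entry (curve_chart k c) m = m`!%:R^-1 *: derive1n m c 0.
  case: m => [_|m mk]; first by rewrite /= invr1 scale1r.
  by rewrite /= insubT /= ffunE.
have -> : (if l == 0%N :> nat then derive1n 1 c 0 else zcoord Gamma c l.+1) =
    zcoord Gamma c l.+1.
  (* at order 1 the sum is empty and z^1 is the velocity *)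
  case: eqP => // ->; rewrite /zcoord big_geq// addr0 fact0 !invr1.
  by rewrite !scale1r.
rewrite ffunE /zcoord scalerDr scalerA -invfM -natrM -factS; congr (_ + _ *: _).
apply: eq_big_nat => j /andP[j1 jl].
have jk : (l.+1 - j <= k)%N by rewrite (leq_trans (leq_subr _ _)).
have tr : jet_trunc j (curve_chart k c) = taylor j c.
  apply/ffunP => i; rewrite !ffunE ent//.
  rewrite -ltnS (leq_trans (ltn_ord i))// (leq_trans jl)//; exact: ltnW (ltn_ord l).
rewrite tr ent// (connM_connL oO sG); last first.
  by rewrite /fibre_over /= ffunE fact0 invr1 scale1r.
rewrite clinZ scalerA; congr (_ *: _).
have -> : (l.+1 - j)%N = (l.+1 - j - 1).+1 by rewrite subn1 prednK// subn_gt0.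
by rewrite subn1 fact_invS.
Qed.

End Triangular.

(** * Polynomial curves *)

Section PolynomialCurves.
Context {R : realType}.
Implicit Types V W : normedModType R.

Lemma scale_linear_r V (a : R^o) : linear (fun v : V => a *: v).
Proof. by move=> b u v; rewrite scalerDr !scalerA mulrC. Qed.
Lemma scale_linear_l V (v : V) : linear (fun a : R^o => a *: v).
Proof. by move=> b s t; rewrite scalerDl scalerA. Qed.
Lemma scale_bounded V : exists r, forall (a : R^o) (v : V), `|a *: v| <= r * `|a| * `|v|.
Proof. by exists 1 => a v; rewrite mul1r normrZ. Qed.
Definition scale_bilin V : clin R^o (clin V V) :=
  bounded_bilin (@scale_linear_r V) (@scale_linear_l V) (@scale_bounded V).

Lemma scale_bilinE V t (v : V) : scale_bilin V t v = t *: v. Proof. by []. Qed.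

Lemma derive1n_zero V j : derive1n j (fun=> 0 : V) = (fun=> 0) :> (R -> V).
Proof.
elim: j => [//|j IH]; rewrite derive1nS IH.
by apply/funext => t; exact: derive1_cst.
Qed.

Definition monomial V (m : nat) (v : V) : R^o -> V := fun t => t ^+ m *: v.

Lemma monomialS V m (v : V) : monomial m.+1 v =
  fun t => scale_bilin V t (monomial m v t).
Proof. by apply/funext => t; rewrite /monomial exprS -scalerA. Qed.

Lemma smooth_monomial V m (v : V) : smooth_on setT (monomial m v).
Proof.
elim: m => [|m IH].
  rewrite /monomial; under eq_fun do rewrite expr0.
  exact/smooth_cst/openT.
rewrite monomialS; apply: (smooth_bilin openT) IH.
exact: (smooth_clin openT (clin_id R^o)).
Qed.

Lemma derive1_monomial0 V (v : V) : derive1 (monomial 0 v : R -> V) = fun=> 0.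
Proof.
apply/funext => t; rewrite -(derive1_cst v t); congr (derive1 _ t).
by apply/funext => s; rewrite /monomial expr0 scale1r.
Qed.

Lemma derive1_monomial V m (v : V) :
  derive1 (monomial m.+1 v : R -> V) = monomial m (m.+1%:R *: v).
Proof.
elim: m v => [|m IH] v; apply/funext => t; rewrite monomialS;
    rewrite (derive1_bilin (scale_bilin V) (smooth_clin openT (clin_id R^o))
      (smooth_monomial _ v) I);
    rewrite [derive1 (clin_id R^o : R -> R) t]derive1_id.
  rewrite !scale_bilinE derive1_monomial0 scaler0 addr0.
  by rewrite /monomial expr0 !scale1r.
rewrite !scale_bilinE IH scale1r /monomial !scalerA -scalerDl; congr (_ *: v).
by rewrite ?mulrA -exprS -[m.+2%:R]natr1 mulrDr mulr1 addrC.
Qed.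

Lemma derive1n_monomial V j m (v : V) :
  derive1n j (monomial m v : R -> V) 0 = if j == m then m`!%:R *: v else 0.
Proof.
elim: j m v => [|j IH] [|m] v.
- by rewrite /= /monomial expr0.
- by rewrite /= /monomial expr0n scale0r.
- by rewrite derive1Sn derive1_monomial0 derive1n_zero.
rewrite derive1Sn derive1_monomial IH eqSS; case: ifP => // _.
by rewrite scalerA -natrM mulnC -factS.
Qed.

Lemma derive1n_sum V n (f : 'I_n -> R^o -> V) j :
  (forall i, smooth_on setT (f i)) ->
  derive1n j (fun t : R => \sum_i f i t) =
  (fun t => \sum_i derive1n j (f i : R -> V) t).
Proof.
move=> sf; elim: j => [//|j IH]; rewrite derive1nS IH.
apply/funext => t.
exact: (derive1_sum_ord openT (fun i => smooth_derive1n openT j (sf i)) I).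
Qed.

(** The coefficients of a polynomial curve are its Taylor coefficients at 0. *)
Lemma polynomial_jet V k (p : V * epow V k) : exists2 c : R^o -> V,
  smooth_on setT c & curve_chart k c = p.
Proof.
exists (fun t => \sum_(m < k.+1) monomial m (jet_entry p m) t).
  by apply: (smooth_sum openT) => m _; exact: smooth_monomial.
have D j : (j < k.+1)%N ->
    derive1n j (fun t : R => \sum_(m < k.+1) monomial m (jet_entry p m) t) 0 =
    j`!%:R *: jet_entry p j.
  move=> jk; rewrite derive1n_sum; last by move=> m; exact: smooth_monomial.
  rewrite (bigD1 (Ordinal jk))//= derive1n_monomial eqxx.
  rewrite big1 ?addr0// => m /negbTE mj; rewrite derive1n_monomial eq_sym.
  by rewrite -[j]/(val (Ordinal jk)) (inj_eq val_inj) mj.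
rewrite [RHS]surjective_pairing; congr pair.
  by have := D 0%N isT; rewrite /= scale1r.
apply/ffunP => l; rewrite ffunE D ?ltnS//.
rewrite scalerA mulVf ?scale1r ?pnatr_eq0 -?lt0n ?fact_gt0//.
by rewrite /= valK.
Qed.

End PolynomialCurves.

(** * Jets and their coordinates *)

(** By injectivity the value chosen in [comp_inv] is the only one available. *)
Lemma comp_inv_val {R : realType} {X : Type} {F G : normedModType R}
    (A : set X) (f : X -> F) (g : X -> G) z :
  {in A &, injective f} -> A z -> comp_inv A f g (f z) = g z.
Proof.
move=> fi Az; rewrite /comp_inv; case: xgetP => [y _ [w [Aw wz] <-]|no].
  by congr g; apply: fi; rewrite ?inE.
by case: (no (g z)); exists z.
Qed.

Section Jets.
Context {R : realType} {E : normedModType R} {M I : Type}.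
Variables (U : I -> set M) (psi : I -> M -> E) (k : nat)
  (Gamma : I -> E -> clin E (clin E E)).
Hypotheses (HM : smooth_atlas U psi) (HG : linear_connection U psi Gamma).

Definition chart_image a : set E := psi a @` U a.
Definition overlap a b : set E := psi a @` (U a `&` U b).
Definition transition a b : E -> E := comp_inv (U a `&` U b) (psi a) (psi b).

Lemma psi_inj_overlap a b : {in U a `&` U b &, injective (psi a)}.
Proof.
move=> x y; rewrite !inE => -[Uax _] [Uay _].
by apply: (atlas_inj HM); rewrite inE.
Qed.

Lemma transitionE a b x : U a x -> U b x -> transition a b (psi a x) = psi b x.
Proof. by move=> ax bx; apply: comp_inv_val => //; exact: psi_inj_overlap. Qed.

Lemma open_overlap a b : open (overlap a b).
Proof. by have [] := atlas_smooth HM a b. Qed.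

Lemma open_chart_image a : open (chart_image a).
Proof. by have := @open_overlap a a; rewrite /overlap setIid. Qed.

Lemma smooth_transition_map a b : smooth_on (overlap a b) (transition a b).
Proof. by have [] := atlas_smooth HM a b. Qed.

Lemma overlap_sub a b : overlap a b `<=` chart_image a.
Proof. by move=> _ [x [Uax _] <-]; exists x. Qed.

Lemma smooth_Gamma a : smooth_on (chart_image a) (Gamma a).
Proof. exact: connection_smooth HG a. Qed.

(** Near 0 a curve through a point of two chart domains stays in both, so the
    calculus of smooth curves applies to its local expressions. *)
Lemma curve_local x g a b : curves U psi x g -> U a x -> U b x ->
  exists A : set R^o, [/\ open A, A 0,
    smooth_on A (psi a \o g : R^o -> E),
    forall t, A t -> overlap a b (psi a (g t)) &
    forall t, A t -> psi b (g t) = transition a b (psi a (g t))].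
Proof.
move=> [g0 [e e0 ge]] Uax Ubx; have [oa sa] := ge a; have [ob _] := ge b.
pose A (c : I) : set R^o := `]- e, e[ `&` g @^-1` U c.
have A0 c : U c x -> A c 0 by split; rewrite /= ?g0// in_itv/= oppr_lt0 e0.
exists (A a `&` A b); split.
- exact: openI.
- by split; exact: A0.
- by apply: smooth_sub sa => t [].
- by move=> t [[_ ga] [_ gb]]; exists (g t).
- by move=> t [[_ ga] [_ gb]]; rewrite transitionE.
Qed.

Lemma curve_base x g a : curves U psi x g -> U a x -> chart_image a ((psi a \o g) 0).
Proof. by move=> [/= -> _] Uax; exists x. Qed.

Lemma curve_triv_covD x g a (l : 'I_k) : curves U psi x g -> U a x ->
  (curve_triv k (Gamma a) (psi a \o g)).2 l =
  (l.+1)`!%:R^-1 *: covD (Gamma a) (psi a \o g) l 0.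
Proof.
move=> cg Uax; have [A [oA A0 sA AO _]] := curve_local cg Uax Uax.
have AO' t : A t -> chart_image a ((psi a \o g) t) by move=> /AO/overlap_sub.
rewrite -(zcoord_covD (open_chart_image a) (smooth_Gamma a) oA sA AO' l A0).
rewrite ffunE; case: eqP => // ->; rewrite /zcoord big_geq// addr0 fact0 !invr1.
by rewrite !scale1r.
Qed.

(** The fibre coordinates are covariant derivatives of the velocity up to constant
    factors, and these transform linearly under the differential of the
    transition map. *)
Lemma curve_triv_transition x g a b : curves U psi x g -> U a x -> U b x ->
  curve_triv k (Gamma b) (psi b \o g) =
  let p := curve_triv k (Gamma a) (psi a \o g) in
  (transition a b p.1, [ffun i => diffL (transition a b) p.1 (p.2 i)]).
Proof.
move=> cg Uax Ubx; have [A [oA A0 sA AO hA]] := curve_local cg Uax Ubx.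
rewrite /= [LHS]surjective_pairing; congr pair; first exact: hA.
apply/ffunP => i; rewrite [RHS]ffunE !(curve_triv_covD (x := x))// clinZ; congr (_ *: _).
apply: (covD_natural i (O := overlap a b) (A := A)) => //.
- exact: smooth_transition_map.
- exact/smooth_sub/smooth_Gamma/overlap_sub.
- by move=> z xi y Oz; exact: (connection_transition HG).
Qed.

Definition jet_shear a := shear (lower_part (k := k) (Gamma a)).
Definition jet_unshear a := unshear (lower_part (k := k) (Gamma a)).

Lemma jet_shearK a : cancel (jet_shear a) (jet_unshear a).
Proof. exact: shearK (@lower_part_low _ _ _ _). Qed.
Lemma jet_unshearK a : cancel (jet_unshear a) (jet_shear a).
Proof. exact: unshearK (@lower_part_low _ _ _ _). Qed.

Lemma curve_triv_chart x g a : curves U psi x g -> U a x ->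
  curve_triv k (Gamma a) (psi a \o g) = jet_shear a (curve_chart k (psi a \o g)).
Proof.
move=> cg Uax; apply: (curve_triv_shear k (open_chart_image a) (smooth_Gamma a)).
exact: curve_base cg Uax.
Qed.

Lemma curve_chart_eqP (c1 c2 : R -> E) : c1 0 = c2 0 ->
  curve_chart k c1 = curve_chart k c2 <->
  (forall j, (1 <= j <= k)%N -> derive1n j c1 0 = derive1n j c2 0).
Proof.
move=> c0; split=> [[_ /ffunP e] [//|j] /= jk|e].
  have := e (Ordinal jk); rewrite !ffunE => /scalerI; apply.
  by rewrite invr_eq0 pnatr_eq0 -lt0n fact_gt0.
by congr pair => //; apply/ffunP => l; rewrite !ffunE e//= .
Qed.

(** Contact of order k in one chart implies contact in another. Through the
    invertible triangular maps this reduces to the transition of the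
    trivializations, so no higher chain rule is needed. *)
Lemma curve_chart_eq_chart x g1 g2 a b : curves U psi x g1 -> curves U psi x g2 ->
  U a x -> U b x ->
  curve_chart k (psi a \o g1) = curve_chart k (psi a \o g2) ->
  curve_chart k (psi b \o g1) = curve_chart k (psi b \o g2).
Proof.
move=> c1 c2 Uax Ubx e; apply: (can_inj (jet_shearK b)).
rewrite -(curve_triv_chart c1 Ubx) -(curve_triv_chart c2 Ubx).
rewrite (curve_triv_transition c1 Uax Ubx) (curve_triv_transition c2 Uax Ubx).
by rewrite (curve_triv_chart c1 Uax) (curve_triv_chart c2 Uax) e.
Qed.

Lemma jet_equivP x g1 g2 a : curves U psi x g1 -> curves U psi x g2 -> U a x ->
  jet_equiv U psi k x g1 g2 <->
  curve_chart k (psi a \o g1) = curve_chart k (psi a \o g2).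
Proof.
move=> c1 c2 Uax.
have e0 b : (psi b \o g1) 0 = (psi b \o g2) 0 by rewrite /= c1.1 c2.1.
split=> [[b Ubx /(curve_chart_eqP (e0 b))]|/(curve_chart_eqP (e0 a)) e].
  exact: (curve_chart_eq_chart c1 c2 Ubx Uax).
by exists a.
Qed.

Lemma chart_cover x : exists a, U a x.
Proof.
have : (\bigcup_a U a) x by rewrite (atlas_cover HM).
by case=> a _ ?; exists a.
Qed.

(** Reflexivity, symmetry and transitivity of the relation of contact, which is
    stated with an unspecified chart, follow by reading it in a fixed chart. *)
Lemma jet_class_eqP x g1 g2 a : curves U psi x g1 -> curves U psi x g2 -> U a x ->
  jet_class U psi k x g1 = jet_class U psi k x g2 <->
  curve_chart k (psi a \o g1) = curve_chart k (psi a \o g2).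
Proof.
move=> c1 c2 Uax; split=> [e|e].
  apply/(jet_equivP c1 c2 Uax).
  have : jet_class U psi k x g2 g2 by split=> //; exact/(jet_equivP c2 c2 Uax).
  by rewrite -e => -[].
apply/seteqP; split=> g [cg] /(jet_equivP _ cg Uax) eg; split=> //.
  by apply/(jet_equivP c2 cg Uax); rewrite -eg.
by apply/(jet_equivP c1 cg Uax); rewrite e eg.
Qed.

Let T := jet U psi k.
Let base : T -> M := jet_base U psi k.

Lemma jet_repr_curves (u : T) : curves U psi (base u) (jet_repr u).
Proof. by rewrite /jet_repr; case: cid2. Qed.

Lemma jet_repr_class (u : T) : jet_curves u = jet_class U psi k (base u) (jet_repr u).
Proof. by rewrite /jet_repr; case: cid2. Qed.

Lemma jet_eqP (u v : T) : base u = base v -> jet_curves u = jet_curves v -> u = v.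
Proof.
case: u v => x C p [y D q]; rewrite /base /= => xy CD; subst y; subst D.
by congr Jet; exact: Prop_irrelevance.
Qed.

Lemma jet_chart_of a x g (hg : curves U psi x g) : U a x ->
  jet_chart U psi k a (jet_of k hg) = curve_chart k (psi a \o g).
Proof.
move=> Uax; apply/(jet_class_eqP (jet_repr_curves (jet_of k hg)) hg Uax).
by rewrite -[LHS](jet_repr_class (jet_of k hg)).
Qed.

Lemma jet_trivE a (u : T) : U a (base u) ->
  jet_triv U psi k Gamma a u = jet_shear a (jet_chart U psi k a u).
Proof. by move=> Uau; exact: curve_triv_chart (jet_repr_curves u) Uau. Qed.

Lemma jet_triv_of a x g (hg : curves U psi x g) : U a x ->
  jet_triv U psi k Gamma a (jet_of k hg) = curve_triv k (Gamma a) (psi a \o g).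
Proof.
by move=> Uax; rewrite jet_trivE// jet_chart_of// -(curve_triv_chart hg Uax).
Qed.

Lemma jet_triv_transition a b (u : T) : U a (base u) -> U b (base u) ->
  jet_triv U psi k Gamma b u =
  let p := jet_triv U psi k Gamma a u in
  (transition a b p.1, [ffun i => diffL (transition a b) p.1 (p.2 i)]).
Proof. by move=> *; apply: (curve_triv_transition (jet_repr_curves u)). Qed.

Lemma jet_chart1 a (u : T) : (jet_chart U psi k a u).1 = psi a (base u).
Proof. by rewrite /jet_chart/= (jet_repr_curves u).1. Qed.

Lemma jet_triv1 a (u : T) : (jet_triv U psi k Gamma a u).1 = psi a (base u).
Proof. by rewrite /jet_triv/= (jet_repr_curves u).1. Qed.

Lemma jet_chart_inj a : {in jet_dom U psi k a &, injective (jet_chart U psi k a)}.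
Proof.
move=> u v; rewrite !inE => Uau Uav e.
have uv : base u = base v.
  by apply: (atlas_inj HM (a := a)); rewrite ?inE// -!jet_chart1 e.
apply: (jet_eqP uv); rewrite !jet_repr_class.
have cv := jet_repr_curves v; rewrite -uv in cv *.
exact/(jet_class_eqP (jet_repr_curves u) cv Uau).
Qed.

Lemma jet_triv_inj a : {in jet_dom U psi k a &, injective (jet_triv U psi k Gamma a)}.
Proof.
move=> u v uU vU; move: (uU) (vU); rewrite !inE => Uau Uav.
rewrite (jet_trivE Uau) (jet_trivE Uav) => /(can_inj (jet_shearK a)).
exact: jet_chart_inj.
Qed.

(** A curve in the model space that starts in the image of a chart is lifted on an
    interval on which it stays there. The points outside are lifted arbitrarily:
    only the germ at 0 matters. *)
Lemma curve_lift a (c : R^o -> E) : smooth_on setT c -> chart_image a (c 0) ->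
  exists x g, [/\ curves U psi x g, U a x, psi a x = c 0 &
    curve_chart k (psi a \o g) = curve_chart k c].
Proof.
move=> sc [x Uax xc].
have /choice[g gP] t : exists y, chart_image a (c t) -> U a y /\ psi a y = c t.
  have [[y Uay yc]|no] := pselect (chart_image a (c t)); first by exists y.
  by exists x.
have [] : \forall t \near (0 : R^o), chart_image a (c t).
  have cc : {for (0 : R^o), continuous c} by apply: (smooth_continuous sc).
  apply: cc; apply: open_nbhs_nbhs; split; first exact: open_chart_image.
  by exists x.
move=> e /= e0 ec.
have eI t : t \in `]- e, e[ -> chart_image a (c t).
  by rewrite in_itv/= => te; apply: ec; rewrite /= sub0r normrN ltr_norml.
have I0 : 0 \in `]- e, e[ by rewrite in_itv/= oppr_lt0 e0.
have g0 : g 0 = x.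
  have [Uag gc] := gP 0 (eI 0 I0).
  by apply: (atlas_inj HM (a := a)); rewrite ?inE// gc xc.
exists x, g; split=> //; last first.
  have oI : open (`]- e, e[%classic : set R) by exact: interval_open.
  have gc t : `]- e, e[%classic t -> (psi a \o g) t = c t by move=> /eI/gP[].
  congr pair; first by rewrite gc.
  by apply/ffunP => l; rewrite !ffunE (derive1n_eq_on _ oI gc).
split=> //; exists e => // b.
have -> : `]- e, e[%classic `&` g @^-1` U b =
    (`]- e, e[%classic `&` c @^-1` overlap a b : set R^o).
  apply/seteqP; split=> t [te]; have [Uag gc] := gP t (eI t te).
    by move=> Ubg; split=> //; exists (g t).
  move=> [y [Uay Uby]] yc; split=> //=.
  suff -> : g t = y by [].
  by apply: (atlas_inj HM (a := a)); rewrite ?inE// gc.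
have oA : open (`]- e, e[%classic `&` c @^-1` overlap a b : set R^o).
  apply: openI; first exact: interval_open.
  apply: open_comp; last exact: open_overlap.
  by move=> t _; apply: (smooth_continuous sc).
split=> //.
have sc' : smooth_on (`]- e, e[%classic `&` c @^-1` overlap a b : set R^o) c.
  exact: smooth_sub sc.
apply: (smooth_ext oA) (smooth_comp (B := overlap a b) oA _ sc' (smooth_transition_map a b)).
  move=> t [te [y [Uay Uby] yc]]; have [Uag gc] := gP t (eI t te).
  rewrite -yc transitionE//; congr (psi b _).
  by apply: (atlas_inj HM (a := a)); rewrite ?inE// gc.
by move=> t [].
Qed.

Lemma jet_chart_surj a (p : E * epow E k) : chart_image a p.1 ->
  exists2 u : T, U a (base u) & jet_chart U psi k a u = p.
Proof.
move=> Op; have [c sc cp] := polynomial_jet p.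
have c0 : c 0 = p.1 by rewrite -cp.
have [|x [g [cg Uax xc gc]]] := curve_lift sc (a := a); first by rewrite c0.
by exists (jet_of k cg) => //; rewrite jet_chart_of// gc.
Qed.

Lemma jet_triv_surj a (p : E * epow E k) : chart_image a p.1 ->
  exists2 u : T, U a (base u) & jet_triv U psi k Gamma a u = p.
Proof.
move=> Op; have [|u Uau e] := jet_chart_surj (a := a) (p := jet_unshear a p).
  by [].
by exists u => //; rewrite jet_trivE// e jet_unshearK.
Qed.

End Jets.

(** * The vector bundle of jets *)

Section PowerMap.
Context {R : realType} (E : normedModType R) (k : nat).

Lemma pow_linear (L : clin E E) : linear (fun v : epow E k => [ffun i => L (v i)] : epow E k).
Proof. by move=> a u v; apply/ffunP => i; rewrite !ffunE clin_linear. Qed.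

Lemma pow_bound (L : clin E E) (v : epow E k) :
  `|[ffun i => L (v i)] : epow E k| <= 1 * `|L| * `|v|.
Proof.
rewrite mul1r; apply: epow_norm_le => [|i]; first exact: mulr_ge0.
rewrite ffunE (le_trans (clin_norm_bound _ _))// ler_wpM2l//.
exact: epow_norm_ge.
Qed.

Lemma pow_linear_l (v : epow E k) :
  linear (fun L : clin E E => [ffun i => L (v i)] : epow E k).
Proof. by move=> a L L'; apply/ffunP => i; rewrite !ffunE. Qed.

(** The action of L(E, E) on E^k by the same operator in each factor; being linear
    and continuous in the operator, it makes the cocycle smooth as a map into
    L(E^k, E^k). *)
Definition pow_clin : clin (clin E E) (clin (epow E k) (epow E k)) :=
  bounded_bilin pow_linear pow_linear_l (ex_intro _ _ pow_bound).

End PowerMap.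

(** Openness and smoothness only have to be checked for one explicit formula of the
    transition map on an explicit open set. *)
Lemma smooth_transition_intro {R : realType} {X : Type} {F G : normedModType R}
    (A : set X) (f : X -> F) (g : X -> G) (O : set F) (H : F -> G) :
  {in A &, injective f} -> f @` A = O -> open O -> smooth_on O H ->
  (forall z, A z -> H (f z) = g z) -> smooth_transition A f g.
Proof.
move=> fi fA oO sH HE; split; rewrite fA//; apply: (smooth_ext oO) sH.
by rewrite -fA => _ [z Az <-]; rewrite HE// comp_inv_val//.
Qed.

Section Bundle.
Context {R : realType} {E : normedModType R} {M I : Type}.
Variables (U : I -> set M) (psi : I -> M -> E) (k : nat)
  (Gamma : I -> E -> clin E (clin E E)).
Hypotheses (HM : smooth_atlas U psi) (HG : linear_connection U psi Gamma).

Let T := jet U psi k.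
Let base : T -> M := jet_base U psi k.
Let V := jet_dom U psi k.
Let Psi := jet_chart U psi k.
Let Phi := jet_triv U psi k Gamma.
Let h := transition U psi.
Let O := overlap U psi.
Let model (D : set E) : set (E * epow E k) := [set p | D p.1].

Definition triv_transition a b (p : E * epow E k) : E * epow E k :=
  (transition U psi a b p.1, [ffun i => diffL (transition U psi a b) p.1 (p.2 i)]).

Let S := triv_transition.

Let oM D : open D -> open (model D).
Proof. exact: open_jet_dom_model. Qed.

Let oO a b : open (O a b). Proof. exact: open_overlap. Qed.

Let O_h a b x : O a b x -> O b a (h a b x).
Proof. by move=> [y [Uay Uby] <-]; rewrite /h transitionE//; exists y. Qed.

Let sfst D : open D -> smooth_on (model D) fst.
Proof. by move=> oD; exact: (smooth_clin (oM oD) (fst_clin E (epow E k))). Qed.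

Let sG a b : smooth_on (O a b) (Gamma a).
Proof. exact/smooth_sub/(smooth_Gamma HG)/overlap_sub. Qed.

Let sS a b : smooth_on (model (O a b)) (S a b).
Proof.
have oD := oM (@oO a b); have s1 := sfst (@oO a b).
have sh := smooth_transition_map HM a b.
have O1 p : model (O a b) p -> O a b p.1 by [].
apply: smooth_pair => //; first exact: (smooth_comp oD O1 s1 sh).
apply: smooth_ffun => // i; apply: (smooth_app oD).
  exact: (smooth_comp oD O1 s1 (smooth_diffL sh)).
exact: (smooth_coord i oD (smooth_clin oD (snd_clin E (epow E k)))).
Qed.

Let sshear a b : smooth_on (model (O a b)) (jet_shear (k:=k) Gamma a).
Proof.
apply: smooth_shear; first exact/oM/oO.
exact: smooth_lower_part (@oO a b) (@sG a b).
Qed.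

Let sunshear a b : smooth_on (model (O a b)) (jet_unshear (k:=k) Gamma a).
Proof.
apply: smooth_unshear => //; first exact/oM/oO.
exact: smooth_lower_part (@oO a b) (@sG a b).
Qed.

Let in_overlap a b u : V a u -> O a b (psi a (base u)) -> (V a `&` V b) u.
Proof.
move=> Vau [y [Uay Uby] e]; split=> //; change (U b (base u)).
suff <- : y = base u by [].
by apply: (atlas_inj HM (a := a)); rewrite ?inE.
Qed.

Let Psi1 a u : (Psi a u).1 = psi a (base u). Proof. exact: jet_chart1. Qed.
Let Phi1 a u : (Phi a u).1 = psi a (base u). Proof. exact: jet_triv1. Qed.

Let Psi_image a b : Psi a @` (V a `&` V b) = model (O a b).
Proof.
apply/seteqP; split=> [_ [u [Vau Vbu] <-]|p Op].
  by change (O a b (Psi a u).1); rewrite Psi1; exists (base u).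
have [u Vau e] := jet_chart_surj HM HG (overlap_sub Op).
exists u => //; apply: in_overlap => //.
by rewrite -Psi1 /Psi e.
Qed.

Let Phi_image a b : Phi a @` (V a `&` V b) = model (O a b).
Proof.
apply/seteqP; split=> [_ [u [Vau Vbu] <-]|p Op].
  by change (O a b (Phi a u).1); rewrite Phi1; exists (base u).
have [u Vau e] := jet_triv_surj HM HG (overlap_sub Op).
exists u => //; apply: in_overlap => //.
by rewrite -Phi1 /Phi e.
Qed.

Let Psi_inj a b : {in V a `&` V b &, injective (Psi a)}.
Proof.
move=> u v; rewrite !inE => -[Vau _] [Vav _].
by apply: (jet_chart_inj HM HG); rewrite inE.
Qed.

Let Phi_inj a b : {in V a `&` V b &, injective (Phi a)}.
Proof.
move=> u v; rewrite !inE => -[Vau _] [Vav _].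
by apply: (jet_triv_inj HM HG); rewrite inE.
Qed.

Let PhiE a u : V a u -> Phi a u = jet_shear (k:=k) Gamma a (Psi a u).
Proof. by move=> Vau; exact: (jet_trivE HM HG Vau). Qed.

Let PsiE a u : V a u -> Psi a u = jet_unshear (k:=k) Gamma a (Phi a u).
Proof. by move=> Vau; rewrite PhiE// jet_shearK. Qed.

Let Phi_S a b u : (V a `&` V b) u -> S a b (Phi a u) = Phi b u.
Proof. by move=> [Vau Vbu]; rewrite /Phi (jet_triv_transition HM HG Vau Vbu). Qed.

Let S_model a b p : model (O a b) p -> model (O b a) (S a b p).
Proof. exact: O_h. Qed.

Let sSs a b : smooth_on (model (O a b)) (fun p => S a b (jet_shear (k:=k) Gamma a p)).
Proof.
have oD := oM (@oO a b).
by apply: (smooth_comp (B := model (O a b)) oD _ (@sshear a b) (@sS a b)).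
Qed.

Let suS a b : smooth_on (model (O a b)) (fun p => jet_unshear (k:=k) Gamma b (S a b p)).
Proof.
have oD := oM (@oO a b).
exact: (smooth_comp oD (@S_model a b) (@sS a b) (@sunshear b a)).
Qed.

(* The change of Taylor coordinates is the composition of two triangular maps with
   the change of trivialization, which proves its smoothness without a formula for
   the higher derivatives of a composition. *)
Let atlas_jet : smooth_atlas V Psi.
Proof.
split.
- by apply/seteqP; split=> // u _; have [a Uau] := chart_cover HM (base u); exists a.
- by move=> a; exact: jet_chart_inj HM HG _.
move=> a b; have oD := oM (@oO a b).
apply: (smooth_transition_intro (@Psi_inj a b) (Psi_image a b) oD
  (H := fun p => jet_unshear (k:=k) Gamma b (S a b (jet_shear (k:=k) Gamma a p)))).
  apply: (smooth_comp (B := model (O a b)) (f := jet_shear (k:=k) Gamma a) oD _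
    (@sshear a b) (@suS a b)).
  by [].
move=> u Vu; have [Vau Vbu] := Vu.
by rewrite -(PhiE Vau) Phi_S// -PsiE.
Qed.

Let proj_smooth : smooth_map V Psi U psi base.
Proof.
move=> a b; have oD := oM (@oO a b).
apply: (smooth_transition_intro (@Psi_inj a b) (Psi_image a b) oD
  (H := fun p => h a b p.1)).
  apply: (smooth_comp (B := O a b) oD _ (sfst (@oO a b)) (smooth_transition_map HM a b)).
  by [].
by move=> u [Vau Vbu]; rewrite /Psi jet_chart1 /h transitionE.
Qed.

Let triv_smooth a j :
  smooth_transition (base @^-1` U a `&` V j) (Phi a) (Psi j) /\
  smooth_transition (base @^-1` U a `&` V j) (Psi j) (Phi a).
Proof.
split.
  apply: (smooth_transition_intro (@Phi_inj a j) (Phi_image a j)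
    (oM (@oO a j)) (@suS a j)).
  by move=> u Vu; rewrite Phi_S// -PsiE//; exact: Vu.2.
rewrite setIC; apply: (smooth_transition_intro (@Psi_inj j a) (Psi_image j a)
    (oM (@oO j a)) (@sSs j a)).
by move=> u Vu; rewrite -PhiE ?Phi_S//; exact: Vu.1.
Qed.

Let S_linear a b x u v (c : R) :
  (S a b (x, c *: u + v)).2 = c *: (S a b (x, u)).2 + (S a b (x, v)).2.
Proof. by apply/ffunP => i; rewrite !ffunE clin_linear. Qed.

(* The combination is formed in one chart around the base point; it is the right one
   in every chart because the changes of trivialization are fibrewise linear. *)
Let fibre_comb c u v : exists w : T, base w = base u /\
  (base u = base v -> forall a, U a (base u) ->
     (Phi a w).2 = c *: (Phi a u).2 + (Phi a v).2).
Proof.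
have [a Uau] := chart_cover HM (base u).
have [|w Vaw wE] := jet_triv_surj HM HG (a := a)
  (p := (psi a (base u), c *: (Phi a u).2 + (Phi a v).2)).
  by exists (base u).
have wu : base w = base u.
  by apply: (atlas_inj HM (a := a)); rewrite ?inE// -Phi1 /Phi wE.
exists w; split=> // uv b Ubu.
have Sw z : base z = base u -> Phi b z = S a b (psi a (base u), (Phi a z).2).
  move=> zu; rewrite -(Phi_S (a := a)); last by split; rewrite /V/jet_dom/= -/(base z) zu.
  by rewrite [Phi a z]surjective_pairing Phi1 zu.
by rewrite !Sw// -S_linear /Phi wE.
Qed.

Let fibre : exists (add : T -> T -> T) (scale : R -> T -> T),
  forall a x, U a x ->
    (forall u v, base u = x -> base v = x ->
      base (add u v) = x /\ (Phi a (add u v)).2 = (Phi a u).2 + (Phi a v).2) /\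
    (forall c u, base u = x ->
      base (scale c u) = x /\ (Phi a (scale c u)).2 = c *: (Phi a u).2).
Proof.
have /choice[comb combP] (q : R * (T * T)) := fibre_comb q.1 q.2.1 q.2.2.
(* u + v is 1 u + v, and c u is (c - 1) u + u *)
exists (fun u v => comb (1, (u, v))), (fun c u => comb (c - 1, (u, u))).
move=> a x Uax; split=> [u v ux vx|c u ux].
  have [/= bw e] := combP (1, (u, v)); rewrite bw; split=> //.
  by rewrite e ?scale1r// ?ux ?vx.
have [/= bw e] := combP (c - 1, (u, u)); rewrite bw; split=> //.
by rewrite e ?ux// scalerBl scale1r subrK.
Qed.

Lemma triv_transition_comp_inv a b x (xi : epow E k) : O a b x ->
  comp_inv (V a `&` V b) (Phi a) (Phi b) (x, xi) = S a b (x, xi).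
Proof.
move=> Ox; have : model (O a b) (x, xi) by [].
by rewrite -Phi_image => -[u Vu uE]; rewrite -uE Phi_S// comp_inv_val//.
Qed.

Let S_K a b x xi : O a b x -> S b a (S a b (x, xi)) = (x, xi).
Proof.
move=> Ox; have : model (O a b) (x, xi) by [].
rewrite -Phi_image => -[u Vu <-]; by rewrite Phi_S// Phi_S//; case: Vu.
Qed.

Let cocycle a b : exists g : E -> clin (epow E k) (epow E k),
  smooth_on (O a b) g /\
  forall x, O a b x -> @GL _ _ (g x) /\
    forall v, comp_inv (base @^-1` (U a `&` U b)) (Phi a) (Phi b) (x, v) =
      (h a b x, g x v).
Proof.
exists (fun x => pow_clin E k (diffL (h a b) x)); split.
  apply: (smooth_post (@oO a b) (pow_clin E k)).
  exact/smooth_diffL/smooth_transition_map.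
move=> x Ox; split; last by move=> v; exact: triv_transition_comp_inv.
(* The changes of trivialization in the two directions are inverse to each other,
   so their linear parts are, without recourse to the chain rule. *)
have hK : h b a (h a b x) = x.
  by case: Ox => y [Uay Uby] <-; rewrite /h !transitionE.
have S2 c d y v : (S d c (S c d (y, v))).2 =
  pow_clin E k (diffL (h d c) (h c d y)) (pow_clin E k (diffL (h c d) y) v) by [].
exists (pow_clin E k (diffL (h b a) (h a b x))); split=> v.
  by rewrite -S2 S_K.
by have := S2 b a (h a b x) v; rewrite hK => <-; rewrite S_K//; exact: O_h.
Qed.

Lemma jet_vector_bundle : vector_bundle U psi V Psi base Phi.
Proof.
split=> //.
- by move=> a; exact: jet_triv_inj HM HG _.
- move=> a; have := Phi_image a a; rewrite setIid => ->.
  rewrite /model /O /overlap setIid.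
  by apply/seteqP; split=> p /=; [|case].
Qed.

End Bundle.

Theorem theorem3p4 (R : realType) (E : completeNormedModType R) (M I : Type)
    (U : I -> set M) (psi : I -> M -> E) (HM : smooth_atlas U psi)
    (k : nat) (hk : (1 <= k)%N)
    (Gamma : I -> E -> clin E (clin E E)) (HG : linear_connection U psi Gamma) :
  [/\ vector_bundle U psi (jet_dom U psi k) (jet_chart U psi k)
        (jet_base U psi k) (jet_triv U psi k Gamma),
      forall (a : I) (x : M) (g : R -> M) (hg : curves U psi x g), U a x ->
        jet_triv U psi k Gamma a (jet_of k hg) =
        curve_triv k (Gamma a) (psi a \o g)
    & forall (a b : I) (x : E) (xi : epow E k),
        (psi a @` (U a `&` U b)) x ->
        let psi_ba := comp_inv (U a `&` U b) (psi a) (psi b) in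
        comp_inv (jet_dom U psi k a `&` jet_dom U psi k b)
          (jet_triv U psi k Gamma a) (jet_triv U psi k Gamma b) (x, xi) =
        (psi_ba x, [ffun i => diffL psi_ba x (xi i)])].
Proof.
split.
- exact: jet_vector_bundle.
- by move=> a x g hg Uax; exact: jet_triv_of.
- by move=> a b x xi Ox; exact: triv_transition_comp_inv.
Qed.
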